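(* Let $\nu>0$ and let $\{\mu_n\}_{n\in\mathbb{N}\cup\{\infty\}}$ be probability measures on $\mathbb{R}$ satisfying $\sup_n\int_{\mathbb{R}}d\mu_n(x)\,|x|^{\frac{\nu}{4}}<\infty$. If the $L^{(\nu)}$-characteristic functions $\varphi^{(\nu)}_{\mu_n}$ converge pointwise on $\mathbb{R}$ to $\varphi^{(\nu)}_{\mu_\infty}$ as $n\to\infty$, then $\mu_n$ converges vaguely to $\mu_\infty$ as $n\to\infty$.
   Context: For $\nu>0$ the function $\mathbf{e}^{(\nu)}:\mathbb{R}\to\mathbb{C}$ is $$\mathbf{e}^{(\nu)}(x):=u_\nu|x|^{\frac{\nu+1}{2}}\left[J_{-\frac{\nu+1}{\nu+2}}\Big(\frac{|x|^{\frac{\nu}{2}+1}}{\frac{\nu}{2}+1}\Big)+i\operatorname{sgn}(x)\,J_{\frac{\nu+1}{\nu+2}}\Big(\frac{|x|^{\frac{\nu}{2}+1}}{\frac{\nu}{2}+1}\Big)\right],\qquad u_\nu:=\Gamma\big(\tfrac{1}{\nu+2}\big)(\nu+2)^{-\frac{\nu+1}{\nu+2}},$$ extended continuously to $x=0$ by $\mathbf{e}^{(\nu)}(0)=1$; $J_\alpha$ is the Bessel function of the first kind of order $\alpha$. For a probability measure $\mu$ on $\mathbb{R}$ with $\int_{\mathbb{R}}d\mu(x)|x|^{\frac{\nu}{4}}<\infty$, its $L^{(\nu)}$-characteristic function is $$\varphi^{(\nu)}_\mu(q):=\int_{\mathbb{R}}d\mu(x)\,\mathbf{e}^{(\nu)}(qx),\qquad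 q\in\mathbb{R}.$$ Vague convergence means $\int g\,d\mu_n\to\int g\,d\mu_\infty$ for every $g\in C_0(\mathbb{R})$ (continuous functions vanishing at infinity). *)

(* Defs.v *)
From mathcomp Require Export all_boot all_order all_algebra.
From mathcomp Require Export all_classical all_reals all_analysis.
From mathcomp Require Export complex.

Set Implicit Arguments.
Unset Strict Implicit.
Unset Printing Implicit Defensive.

Import Order.TTheory GRing.Theory Num.Theory.
Import numFieldNormedType.Exports.

Local Open Scope classical_set_scope.
Local Open Scope ring_scope.
Local Open Scope complex_scope.

(* Euler's integral; it is the Gamma function only for 0 < z. *)
Definition Gamma {R : realType} (z : R) : R :=
  \int[lebesgue_measure]_(t in `]0, +oo[) (t `^ (z - 1) * expR (- t)).

(* The Bessel function of the first kind J_alpha(x), for -1 < alpha (so that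
   Gamma is only evaluated at positive arguments) and 0 < x.  The functions
   below use the orders alpha = -/+ (nu + 1) / (nu + 2), both in ]-1, 1[. *)
Definition besselJ {R : realType} (alpha x : R) : R :=
  limn (series (fun m : nat =>
    (-1) ^+ m / (m`!%:R * Gamma (m%:R + alpha + 1))
      * (x / 2) `^ (m.*2%:R + alpha))).

Definition u_ {R : realType} (nu : R) : R :=
  Gamma (1 / (nu + 2)) * (nu + 2) `^ (- ((nu + 1) / (nu + 2))).

(* The continuous extension to 0 is explicit: `besselJ` is not meaningful
   at x = 0 for negative orders. *)
Definition evec {R : realType} (nu x : R) : R[i] :=
  if x == 0 then 1 else
  let alpha := (nu + 1) / (nu + 2) in
  let z := `|x| `^ (nu / 2 + 1) / (nu / 2 + 1) in
  (u_ nu * `|x| `^ ((nu + 1) / 2))%:C *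
    ((besselJ (- alpha) z)%:C + 'i%C * (Num.sg x)%:C * (besselJ alpha z)%:C).

(* Componentwise, as for the total operator `Rintegral`: a real or imaginary
   part that has no finite integral contributes a junk value. *)
Definition Cintegral {d : measure_display} {T : measurableType d}
    {R : realType} (mu : {measure set T -> \bar R}) (f : T -> R[i]) : R[i] :=
  (\int[mu]_x complex.Re (f x)) +i* (\int[mu]_x complex.Im (f x)).

Definition Lcharfun {R : realType} (nu : R)
    (mu : probability (measurableTypeR R) R) (q : R) : R[i] :=
  Cintegral mu (fun x : R => evec nu (q * x)).

(* `R[i]^o` carries the topology of the complex modulus. *)
Definition C0 {R : realType} (g : R -> R[i]^o) : Prop :=
  [/\ continuous g, g x @[x --> +oo] --> (0 : R[i]^o)
    & g x @[x --> -oo] --> (0 : R[i]^o)].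

Definition vague_cvg {R : realType}
    (mu : nat -> probability (measurableTypeR R) R)
    (mu_oo : probability (measurableTypeR R) R) : Prop :=
  forall g : R -> R[i]^o, C0 g ->
    (fun n => Cintegral (mu n) g : R[i]^o) @ \oo -->
      (Cintegral mu_oo g : R[i]^o).

(* Main.v *)
Require Import Defs.
From mathcomp Require Import measurable_realfun ring lra.

(** The theorem is true because suitable mixtures over q of the functions
    x |-> e^(nu)(q x) span a dense part of C_0(R), and the integral of such a
    mixture against mu_n is the same mixture of the values phi_n(q), which
    converge by hypothesis.

    Write N = nu + 2, and let F_b(t) = sum_m (-t)^m / (m! Gamma(m + b)) be the
    Bessel-Clifford series [clifford b t].  Up to positive constants, the real
    part of e^(nu)(x) is the even function F_(1/N)(|x|^N / N^2), and its
    imaginary part is the odd function x |x|^nu F_((nu+1)/N + 1)(|x|^N / N^2);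
    this is [evecE].  Three facts carry the proof.

    - Growth.  F_b solves t F'' + b F' + F = 0, and an energy argument for this
      equation gives |F_b(t)| = O(t^(1/4 - b/2)) at infinity
      ([clifford_decay]).  For both parts of e^(nu) the exponents combine to
      |e^(nu)(x)| = O(1 + |x|^(nu/4)), which is exactly the growth that the
      moment hypothesis controls.

    - A Laplace transform.  Integrating termwise,
      int_0^oo t^(b-1) e^(-t) F_b(s t) dt = e^(-s), because the Gamma factors
      cancel ([integral_gamma_clifford]).  With q proportional to t^(1/N), a
      positive mixture of the functions x |-> Re e^(nu)(q x) is therefore
      exp(-s |x|^N), and one of the functions x |-> Im e^(nu)(q x) is
      x |x|^nu exp(-s |x|^N).

    - Exchange of limits.  By the growth bound, Fubini's theorem turns the
      integral of such a mixture against mu_n into the mixture of the values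
      phi_n(q); these converge by dominated convergence, the uniform moment
      bound providing the majorant ([cvg_integral_mix]).

    Hence the integrals of exp(-s |x|^N) and of x |x|^nu exp(-s |x|^N) against
    mu_n converge to those against mu_oo for every s > 0.  By Weierstrass'
    theorem in the variable y = exp(-|x|^N), the linear combinations of the
    first family and of the constants approximate uniformly the even functions
    of C_0(R) ([cvg_int_even]), and those of the second family the odd ones
    ([cvg_int_odd]).  As all the measures have mass one, convergence of the
    integrals passes to uniform limits ([cvg_int_unif]). *)

Set Implicit Arguments.
Unset Strict Implicit.
Unset Printing Implicit Defensive.

Import Order.TTheory GRing.Theory Num.Theory.
Import numFieldNormedType.Exports.

Local Open Scope classical_set_scope.
Local Open Scope ring_scope.

(** * The Gamma integral *)

Section gamma.
Context {R : realType}.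
Implicit Types b t : R.
Notation leb := (@lebesgue_measure R).

Definition gamma_fun b t : R := t `^ (b - 1) * expR (- t).

Lemma gamma_fun_ge0 b t : 0 <= gamma_fun b t.
Proof. by rewrite mulr_ge0 ?powR_ge0 ?expR_ge0. Qed.

Lemma measurable_abs_powR (a : R) : measurable_fun setT (fun x : R => `|x| `^ a).
Proof.
by apply: (@measurableT_comp _ _ _ _ _ _ (fun x : R => x `^ a)).
Qed.

Lemma measurable_gamma_fun b (D : set R) : measurable_fun D (gamma_fun b).
Proof.
apply: measurable_funTS; apply: measurable_funM.
  exact: measurable_powR.
by apply: measurableT_comp => //; exact: measurableT_comp.
Qed.

Lemma is_derive_expRN t : is_derive t 1 (fun x : R => - expR (- x)) (expR (- t)).
Proof.
have -> : expR (- t) = - (expR (- t) * (- 1)) by rewrite mulrN1 opprK.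
apply: is_deriveN; apply: is_derive1_comp.
Qed.

Lemma continuous_expRN : continuous (fun x : R => expR (- x)).
Proof.
by move=> x; apply: continuous_comp; [exact: continuousN|exact: continuous_expR].
Qed.

Lemma continuous_powR b t : 0 < t -> {for t, continuous (fun x => x `^ b)}.
Proof.
move=> t0; apply: differentiable_continuous; apply/derivable1_diffP.
by apply: derivable_powR; rewrite in_itv/= t0.
Qed.

(** The recursion Gamma(b + 1) = b Gamma(b) on a compact interval of positive
    numbers, where both integrands are bounded. *)
Lemma gamma_by_parts b x y : 0 <= b -> 0 < x -> x < y ->
  (\int[leb]_(t in `[x, y]) (gamma_fun (b + 1) t)%:E =
   (x `^ b * expR (- x) - y `^ b * expR (- y))%:E +
   b%:E * \int[leb]_(t in `[x, y]) (gamma_fun b t)%:E)%E.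
Proof.
move=> b0 x0 xy.
have inpos t : t \in `[x, y] -> 0 < t.
  by rewrite in_itv/= => /andP[xt _]; exact: lt_le_trans xt.
have cp c : {within `[x, y], continuous (fun t => t `^ c)}.
  by apply: continuous_in_subspaceT => t /set_mem/= txy; apply: continuous_powR; exact: inpos.
have ce : {within `[x, y], continuous (fun t => expR (- t))}.
  by apply: continuous_subspaceT; exact: continuous_expRN.
transitivity (\int[leb]_(t in `[x, y]) (t `^ b * expR (- t))%:E)%E.
  by apply: eq_integral => t _; rewrite /gamma_fun addrK.
rewrite (@integration_by_parts _ _ (fun t => - expR (- t)) (fun t => b * t `^ (b - 1)))//.
- rewrite -[LHS]/(_ - _)%E; congr (_ + _)%E.
    by rewrite !mulrN opprK addrC.
  rewrite -ge0_integralZl//; last 2 first.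
  + by apply/measurable_EFinP; exact: measurable_gamma_fun.
  + by move=> t _; rewrite lee_fin gamma_fun_ge0.
  rewrite -[RHS]oppeK; congr (- _)%E; rewrite -integral_ge0N; last first.
    by move=> t _; rewrite -EFinM lee_fin mulr_ge0 ?gamma_fun_ge0.
  by apply: eq_integral => t _; rewrite /gamma_fun -EFinM -EFinN mulrN mulrA.
- apply: continuous_in_subspaceT => t /set_mem/= txy.
  apply: (@continuousM _ _ (cst b) (fun t => t `^ (b - 1))); first exact: cst_continuous.
  by apply: continuous_powR; exact: inpos.
- split.
  + move=> t /subset_itv_oo_cc txy; apply: derivable_powR.
    by rewrite in_itv/= (inpos _ txy).
  + by apply/cvg_at_right_filter; exact: continuous_powR.
  + by apply/cvg_at_left_filter; apply: continuous_powR; exact: lt_trans xy.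
- move=> t /subset_itv_oo_cc txy; apply: powR_derive1.
  by rewrite in_itv/= (inpos _ txy).
- split.
  + by move=> t _; exact: (ex_derive (is_derive := is_derive_expRN t)).
  + by apply/cvg_at_right_filter; apply: cvgN; exact: continuous_expRN.
  + by apply/cvg_at_left_filter; apply: cvgN; exact: continuous_expRN.
- by move=> t _; rewrite derive1E; exact: (derive_val (is_derive := is_derive_expRN t)).
Qed.

Lemma cvg_powR_expRN b : 0 < b ->
  (fun n : nat => n.+2%:R `^ b * expR (- n.+2%:R) : R) @ \oo --> (0 : R).
Proof.
move=> b0; have [k bk] : exists k : nat, b <= k%:R.
  by exists (Num.Def.archi_bound b); apply: ltW; apply: archi_boundP; exact: ltW.
have key n : n.+2%:R `^ b * expR (- n.+2%:R) <= k.+1`!%:R * n.+2%:R^-1 :> R.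
  rewrite expRN ler_pdivrMr ?expR_gt0// -mulrA.
  have h : n.+2%:R ^+ k.+1 / k.+1`!%:R <= expR (n.+2%:R) :> R.
    have := @expR_ge1Dxn R n.+2%:R k (ler0n _ _).
    by apply: le_trans; rewrite lerDr.
  apply: (@le_trans _ _ (n.+2%:R ^+ k)).
    rewrite -powR_mulrn//; apply: ler_powR => //; by rewrite ler1n.
  rewrite mulrCA -ler_pdivrMl ?invr_gt0// invrK.
  by rewrite -exprS mulrC -ler_pdivrMr ?ltr0n ?fact_gt0 //.
apply: (@squeeze_cvgr _ _ _ _ (cst 0) (fun n => k.+1`!%:R * n.+2%:R^-1)).
- by near=> n; rewrite key andbT mulr_ge0 ?powR_ge0 ?expR_ge0.
- exact: cvg_cst.
- rewrite -[X in _ --> X](mulr0 k.+1`!%:R); apply: cvgMl_tmp.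
  rewrite (cvg_shiftS (fun n : nat => n.+1%:R^-1 : R)).
  exact: cvg_harmonic.
Unshelve. all: by end_near. Qed.

Lemma cvg_powR_harmonic b : 0 < b ->
  (fun n : nat => n.+1%:R^-1 `^ b * expR (- n.+1%:R^-1) : R) @ \oo --> (0 : R).
Proof.
move=> b0; rewrite -[X in _ --> X](mul0r (expR (- 0))); apply: cvgM.
  have /cvg_at_rightP := powR_cvg0 b0; apply.
  by split=> [n|]; [rewrite invr_gt0|exact: cvg_harmonic].
apply: (cvg_comp (fun n => n.+1%:R^-1) (fun x : R => expR (- x))).
  exact: cvg_harmonic.
exact: continuous_expRN.
Qed.

Lemma gamma_fun_cvg b :
  (fun n : nat => \int[leb]_(t in `[(n.+1%:R^-1)%R, n.+2%:R%R]) (gamma_fun b t)%:E)%E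
    @ \oo --> (\int[leb]_(t in `]0%R, +oo[) (gamma_fun b t)%:E)%E.
Proof.
have -> : `]0%R, +oo[%classic = \bigcup_n `[n.+1%:R^-1, n.+2%:R]%classic :> set R.
  apply/seteqP; split=> [t|t [n _]] /=; rewrite !in_itv/= ?andbT.
    move=> t0; have [n tn] : exists n : nat, t^-1 + t < n%:R.
      exists (Num.Def.archi_bound (t^-1 + t)); apply: archi_boundP.
      by rewrite addr_ge0// ?invr_ge0 ltW.
    exists n => //; rewrite /= in_itv/=.
    rewrite -[leRHS]invrK lef_pV2 ?posrE ?invr_gt0//.
    have ti : 0 < t^-1 by rewrite invr_gt0.
    rewrite -2!natr1; lra.
  by move=> /andP[+ _]; apply: lt_le_trans; rewrite invr_gt0.
apply: ge0_nondecreasing_set_cvg_integral => //.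
- apply/nondecreasing_seqP => n; apply/subsetPset => t/=; rewrite !in_itv/=.
  move=> /andP[h1 h2]; apply/andP; split.
    by apply: le_trans h1; rewrite lef_pV2 ?posrE// ler_nat.
  by apply: (le_trans h2); rewrite ler_nat.
- by move=> n; apply/measurable_EFinP; exact: measurable_gamma_fun.
- by move=> n t _; rewrite lee_fin gamma_fun_ge0.
Qed.

(** An identity in the extended reals, so that it can be used to prove that
    the integrals are finite. *)
Lemma gamma_rec_ereal b : 0 < b ->
  (\int[leb]_(t in `]0%R, +oo[) (gamma_fun (b + 1) t)%:E =
   b%:E * \int[leb]_(t in `]0%R, +oo[) (gamma_fun b t)%:E)%E.
Proof.
move=> b0; rewrite -[RHS]add0e.
apply: (cvg_unique _ (@gamma_fun_cvg (b + 1))) => //=.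
under eq_fun => n.
  rewrite gamma_by_parts ?ltW// ?invr_gt0//; last first.
    by rewrite invf_plt ?posrE// (@lt_le_trans _ _ 1)// ?invf_lt1 ?ltr1n// ler1n.
  over.
apply: cvgeD.
- by rewrite fin_num_adde_defr.
- apply: cvg_EFin; first exact: nearW.
  rewrite -[X in _ --> X](subr0 (0 : R)); apply: cvgB.
  + exact: cvg_powR_harmonic.
  + exact: cvg_powR_expRN.
- by apply: cvgeZl => //; exact: gamma_fun_cvg.
Qed.

Lemma integral_gamma_fun1 : (\int[leb]_(t in `]0%R, +oo[) (gamma_fun 1 t)%:E = 1)%E.
Proof.
transitivity (\int[leb]_(t in `[0%R, +oo[) (expR (- t))%:E)%E.
  rewrite -integral_itv_obnd_cbnd//; last first.
    by apply/measurable_EFinP; apply: measurableT_comp => //; exact: measurableT_comp.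
  by apply: eq_integral => t _; rewrite /gamma_fun subrr powRr0 mul1r.
rewrite (@ge0_continuous_FTC2y _ _ (fun x => - expR (- x)) _ 0)//.
- by rewrite oppr0 expR0 EFinN oppeK add0e.
- by apply: continuous_subspaceT; exact: continuous_expRN.
- by rewrite -oppr0; apply: cvgN; exact: cvgr_expR.
- by apply/cvg_at_right_filter; apply: cvgN; exact: continuous_expRN.
- by move=> t _; rewrite derive1E; exact: (derive_val (is_derive := is_derive_expRN t)).
Qed.

Lemma integral_gamma_fun_natS n :
  (\int[leb]_(t in `]0%R, +oo[) (gamma_fun n.+1%:R t)%:E < +oo)%E.
Proof.
elim: n => [|n IH]; first by rewrite integral_gamma_fun1 ltry.
rewrite -natr1 gamma_rec_ereal//.
by apply: lte_mul_pinfty => //; rewrite lee_fin.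
Qed.

(** The recursion moves b to b + 1 >= 1, where t^b <= 1 + t^k for an integer
    k >= b, and the recursion reaches every positive integer from 1. *)
Lemma integral_gamma_fun_lty b : 0 < b ->
  (\int[leb]_(t in `]0%R, +oo[) (gamma_fun b t)%:E < +oo)%E.
Proof.
move=> b0; suff : (\int[leb]_(t in `]0%R, +oo[) (gamma_fun (b + 1) t)%:E < +oo)%E.
  rewrite gamma_rec_ereal//.
  have : (0 <= \int[leb]_(t in `]0%R, +oo[) (gamma_fun b t)%:E)%E.
    by apply: integral_ge0 => t _; rewrite lee_fin gamma_fun_ge0.
  case: (\int[leb]_(t in _) _)%E => //= [r|] _; first by rewrite !ltry.
  by rewrite gt0_muley ?lte_fin.
have [k bk] : exists k : nat, b <= k%:R.
  by exists (Num.Def.archi_bound b); apply: ltW; apply: archi_boundP; exact: ltW.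
apply: (@le_lt_trans _ _ (\int[leb]_(t in `]0%R, +oo[)
    ((gamma_fun 1 t)%:E + (gamma_fun k.+1%:R t)%:E))%E).
  apply: ge0_le_integral => //.
  - by move=> t _; rewrite lee_fin gamma_fun_ge0.
  - by apply/measurable_EFinP; exact: measurable_gamma_fun.
  - by apply: emeasurable_funD; apply/measurable_EFinP; exact: measurable_gamma_fun.
  move=> t; rewrite /= in_itv/= andbT => t0.
  rewrite -EFinD lee_fin /gamma_fun -mulrDl ler_pM2r ?expR_gt0//.
  rewrite addrK subrr powRr0 -natr1 addrK.
  have [t1|t1] := leP t 1.
    rewrite (@le_trans _ _ 1) ?lerDl ?powR_ge0//.
    rewrite -[leRHS](powRr0 t); apply: ger_powR; [by rewrite t0|exact: ltW].
  by rewrite (@le_trans _ _ (t `^ k%:R)) ?lerDr//; apply: ler_powR => //; exact: ltW.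
rewrite ge0_integralD//; [|by move=> t _; rewrite lee_fin gamma_fun_ge0
  |by apply/measurable_EFinP; exact: measurable_gamma_fun
  |by move=> t _; rewrite lee_fin gamma_fun_ge0
  |by apply/measurable_EFinP; exact: measurable_gamma_fun].
by apply: lte_add_pinfty; [rewrite integral_gamma_fun1 ltry|exact: integral_gamma_fun_natS].
Qed.

Lemma integrable_gamma_fun b : 0 < b ->
  leb.-integrable `]0, +oo[ (EFin \o gamma_fun b).
Proof.
move=> b0; apply/integrableP; split.
  by apply/measurable_EFinP; exact: measurable_gamma_fun.
under eq_integral do rewrite /= ger0_norm ?gamma_fun_ge0//.
exact: integral_gamma_fun_lty.
Qed.

Lemma integral_gamma_fun b : 0 < b ->
  (\int[leb]_(t in `]0%R, +oo[) (gamma_fun b t)%:E = (Gamma b)%:E)%E.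
Proof.
move=> b0; rewrite /Gamma /Rintegral fineK//.
exact: integrable_fin_num (integrable_gamma_fun b0).
Qed.

Lemma GammaS b : 0 < b -> Gamma (b + 1) = b * Gamma b.
Proof.
move=> b0; apply: EFin_inj; rewrite EFinM -!integral_gamma_fun ?addr_gt0//.
exact: gamma_rec_ereal.
Qed.

Lemma Gamma_gt0 b : 0 < b -> 0 < Gamma b.
Proof.
move=> b0; rewrite -lte_fin -integral_gamma_fun//.
apply: (@lt_le_trans _ _ (\int[leb]_(t in `[1%R, 2%R]) (expR (- 2) / 2)%:E)%E).
  rewrite integral_cst//= lebesgue_measure_itv/= lte_fin ltr1n -EFinB -EFinM lte_fin.
  by rewrite mulr_gt0// ?divr_gt0 ?expR_gt0// subr_gt0 ltr1n.
apply: (@le_trans _ _ (\int[leb]_(t in `[1%R, 2%R]) (gamma_fun b t)%:E)%E).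
  apply: ge0_le_integral => //.
  - by apply/measurable_EFinP; exact: measurable_gamma_fun.
  move=> t; rewrite /= in_itv/= => /andP[t1 t2].
  have t0 : 0 < t by exact: lt_le_trans t1.
  rewrite lee_fin mulrC ler_pM ?invr_ge0 ?expR_ge0// ?ler_expR ?lerN2//.
  apply: (@le_trans _ _ t^-1); first by rewrite lef_pV2 ?posrE.
  by rewrite -(powR_inv1 (ltW t0)); apply: (@ler_powR R t t1); rewrite lerBrDr addNr ltW.
apply: ge0_subset_integral => //.
- by apply/measurable_EFinP; exact: measurable_gamma_fun.
- by move=> t _; rewrite lee_fin gamma_fun_ge0.
- by move=> t; rewrite /= !in_itv/= andbT => /andP[t1 _]; exact: lt_le_trans t1.
Qed.
End gamma.

(** * The Bessel-Clifford series *)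

Section clifford.
Context {R : realType}.
Implicit Types b t : R.

Definition clifford_coef b (m : nat) : R :=
  (-1) ^+ m / (m`!%:R * Gamma (m%:R + b)).

Lemma clifford_coef0 b : clifford_coef b 0 = (Gamma b)^-1.
Proof. by rewrite /clifford_coef expr0 fact0 add0r !mul1r. Qed.

Definition clifford b t : R := limn (pseries (clifford_coef b) t).

(** In Gamma(m + b) = b (b + 1) ... (b + m - 1) Gamma(b) every factor but the
    first is at least 1. *)
Lemma Gamma_natD_ge b m : 0 < b -> Num.min 1 b * Gamma b <= Gamma (m%:R + b).
Proof.
move=> b0; elim: m => [|m IH].
  by rewrite add0r -[leRHS]mul1r ler_pM2r ?Gamma_gt0// ge_min lexx.
case: m IH => [|m] IH.
  by rewrite addrC GammaS// ler_pM2r ?Gamma_gt0// ge_min lexx orbT.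
apply: (le_trans IH).
have p : 0 < m.+1%:R + b by rewrite addr_gt0.
rewrite -[m.+2%:R]natr1 -addrA [1 + b]addrC addrA GammaS//.
rewrite ler_peMl//; first exact/ltW/Gamma_gt0.
by rewrite -natr1 -addrA [_ + (1 + b)]addrCA lerDl addr_ge0// ltW.
Qed.

Lemma clifford_coef_norm b m : 0 < b ->
  `|clifford_coef b m| = (m`!%:R * Gamma (m%:R + b))^-1.
Proof.
move=> b0; rewrite normrM normrX normrN1 expr1n mul1r normfV gtr0_norm//.
by rewrite mulr_gt0 ?ltr0n ?fact_gt0 ?Gamma_gt0// ltr_wpDl.
Qed.

Definition clifford_bound b : R := (Num.min 1 b * Gamma b)^-1.

Lemma clifford_coef_le b m : 0 < b ->
  `|clifford_coef b m| <= clifford_bound b * m`!%:R^-1.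
Proof.
move=> b0; rewrite clifford_coef_norm// invfM mulrC.
rewrite ler_pM2r ?invr_gt0 ?ltr0n ?fact_gt0// lef_pV2.
- exact: Gamma_natD_ge.
- by rewrite posrE Gamma_gt0// ltr_wpDl.
- by rewrite posrE mulr_gt0 ?Gamma_gt0// lt_min b0 ltr01.
Qed.

Lemma clifford_bound_ge0 b : 0 < b -> 0 <= clifford_bound b.
Proof.
by move=> b0; rewrite invr_ge0 ltW// mulr_gt0 ?Gamma_gt0// lt_min b0 ltr01.
Qed.

Lemma is_cvg_clifford_norm b t : 0 < b ->
  cvgn [normed series (fun m => clifford_coef b m * t ^+ m)].
Proof.
move=> b0.
apply: (@series_le_cvg _ _ (clifford_bound b *: exp_coeff `|t|)) => [m|m|m|].
- exact: normr_ge0.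
- by rewrite /= mulr_ge0 ?clifford_bound_ge0// exp_coeff_ge0.
- rewrite /= -[leRHS]/(_ * (_ / _)) normrM normrX [leRHS]mulrCA mulrC.
  rewrite ler_wpM2l ?exprn_ge0//.
  exact: clifford_coef_le.
- by apply: is_cvg_seriesZ; exact: is_cvg_series_exp_coeff.
Qed.

Lemma is_cvg_clifford b t : 0 < b -> cvgn (pseries (clifford_coef b) t).
Proof. by move=> b0; apply: normed_cvg; exact: is_cvg_clifford_norm. Qed.

Lemma clifford0 b : clifford b 0 = (Gamma b)^-1.
Proof.
apply: lim_near_cst => //; near=> m.
rewrite -[m]prednK; last by near: m; exact: nbhs_infty_gt.
rewrite /pseries /series/= big_nat_recl//= big1 ?addr0.
  by rewrite clifford_coef0 expr0 mulr1.
by move=> i _; rewrite exprS mul0r mulr0.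
Unshelve. all: by end_near. Qed.

Lemma clifford_le_exp b t : 0 < b ->
  `|clifford b t| <= clifford_bound b * expR `|t|.
Proof.
move=> b0; apply: (le_trans (lim_series_norm (@is_cvg_clifford_norm b t b0))).
have -> : clifford_bound b * expR `|t| =
    limn (series (clifford_bound b *: exp_coeff `|t|)).
  by rewrite lim_seriesZ//; exact: is_cvg_series_exp_coeff.
apply: lim_series_le.
- exact: is_cvg_clifford_norm.
- by apply: is_cvg_seriesZ; exact: is_cvg_series_exp_coeff.
- move=> m; rewrite /= -[leRHS]/(_ * (_ / _)) normrM normrX [leRHS]mulrCA mulrC.
  rewrite ler_wpM2l ?exprn_ge0//.
  exact: clifford_coef_le.
Qed.

(** Differentiation shifts b, because (m + 1) / (m + 1)! = 1 / m! and
    Gamma((m + 1) + b) = Gamma(m + (b + 1)): hence F_b' = - F_(b+1). *)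
Lemma clifford_coef_diffs b :
  pseries_diffs (clifford_coef b) = - clifford_coef (b + 1).
Proof.
apply/funext => m; rewrite /pseries_diffs /clifford_coef /= -[RHS]/(- (_ / _)).
have -> : m.+1%:R + b = m%:R + (b + 1) by rewrite -natr1 -addrA [1 + b]addrC.
rewrite factS natrM exprS mulN1r -[(m.+1%:R * _) * _]mulrA invfM mulNr mulrN mulrCA.
by rewrite mulVKf.
Qed.

Lemma pseries_clifford_coefN b t :
  pseries (- clifford_coef b) t = - pseries (clifford_coef b) t.
Proof.
apply/funext => n; rewrite /pseries -[RHS]/(- (series _ n)) /series/= -sumrN.
by apply: eq_bigr => i _; exact: mulNr.
Qed.

Lemma is_derive_clifford b t : 0 < b ->
  is_derive t 1 (clifford b) (- clifford (b + 1) t).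
Proof.
move=> b0.
have b1 : 0 < b + 1 by rewrite addr_gt0.
have b2 : 0 < b + 1 + 1 by rewrite addr_gt0.
have -> : - clifford (b + 1) t =
    limn (pseries (pseries_diffs (clifford_coef b)) t).
  by rewrite clifford_coef_diffs pseries_clifford_coefN limN//; exact: is_cvg_clifford.
apply: (@pseries_snd_diffs _ _ (`|t| + 1)).
- exact: is_cvg_clifford.
- rewrite clifford_coef_diffs pseries_clifford_coefN; apply: is_cvgN.
  exact: is_cvg_clifford.
- rewrite clifford_coef_diffs pseries_diffsN clifford_coef_diffs opprK.
  exact: is_cvg_clifford.
- by rewrite [ltRHS]ger0_norm ?ltrDl// addr_ge0.
Qed.

Lemma continuous_clifford b : 0 < b -> continuous (clifford b).
Proof.
move=> b0 t; apply: differentiable_continuous; apply/derivable1_diffP.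
exact: (ex_derive (is_derive := @is_derive_clifford b t b0)).
Qed.

Lemma clifford_coef_rec b m : 0 < b ->
  clifford_coef b m.+1 - b * clifford_coef (b + 1) m.+1 =
  - clifford_coef (b + 1 + 1) m.
Proof.
move=> b0; rewrite /clifford_coef.
have -> : m%:R + (b + 1 + 1) = (m.+1%:R + b) + 1 by rewrite -natr1; ring.
have -> : m.+1%:R + (b + 1) = (m.+1%:R + b) + 1 by ring.
have p : 0 < m.+1%:R + b by rewrite addr_gt0.
rewrite GammaS// factS natrM exprS.
have f0 : m`!%:R != 0 :> R by rewrite pnatr_eq0 -lt0n fact_gt0.
have g0 : Gamma (m.+1%:R + b) != 0 by rewrite gt_eqF// Gamma_gt0.
move: (gt_eqF p); move: (Gamma _) g0 => g g0 /negbT p0.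
have m0 : m.+1%:R != 0 :> R by rewrite pnatr_eq0.
move: (_ ^+ m) (m`!%:R) m.+1%:R p0 m0 f0 => e f k p0 m0 f0.
by field; rewrite p0 m0 f0 g0.
Qed.

(** Since F_b' = - F_(b+1), this contiguity relation is the differential
    equation t F'' + b F' + F = 0. *)
Lemma clifford_ode b t : 0 < b ->
  t * clifford (b + 1 + 1) t = b * clifford (b + 1) t - clifford b t.
Proof.
move=> b0.
have b1 : 0 < b + 1 by rewrite addr_gt0.
have b2 : 0 < b + 1 + 1 by rewrite addr_gt0.
apply: oppr_inj; rewrite opprB.
have c1 : - (t * pseries (clifford_coef (b + 1 + 1)) t n) @[n --> \oo] -->
    - (t * clifford (b + 1 + 1) t).
  by apply: cvgN; apply: cvgMl_tmp; exact: is_cvg_clifford.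
apply: (cvg_unique _ c1) => //=.
have -> : (fun n => - (t * pseries (clifford_coef (b + 1 + 1)) t n)) =
  (fun n => pseries (clifford_coef b) t n.+1 - b * pseries (clifford_coef (b + 1)) t n.+1).
  apply/funext => n; rewrite /pseries /series/= !mulr_sumr -sumrB -sumrN.
  rewrite [RHS]big_nat_recl//= [X in _ = X + _](_ : _ = 0); last first.
    rewrite !clifford_coef0 GammaS// invfM expr0 !mulr1 mulrA.
    by rewrite mulfV ?gt_eqF// mul1r subrr.
  rewrite add0r; apply: eq_bigr => i _.
  rewrite exprS mulrA [b * _]mulrA -mulrBl clifford_coef_rec// mulNr.
  by rewrite [t * clifford_coef _ i]mulrC -mulrA.
apply: (@cvgB _ _ _ _ _ (fun n => pseries (clifford_coef b) t n.+1)).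
  by rewrite (cvg_shiftS (pseries (clifford_coef b) t)); exact: is_cvg_clifford.
apply: cvgMl_tmp.
by rewrite (cvg_shiftS (pseries (clifford_coef (b + 1)) t)); exact: is_cvg_clifford.
Qed.

End clifford.

(** * Decay of the Bessel-Clifford series *)

Section energy.
(** With r = sqrt t, f(r) = F_b(r^2) and g(r) = r F_b'(r^2), the equation of F_b
    becomes the system f' = 2 g, g' = - 2 f - 2 p g / r with p = b - 1/2. *)
Context {R : realType}.
Variables (p : R) (f g : R -> R).
Hypothesis df : forall r : R, 0 < r -> is_derive r (1 : R) f (2 * g r).
Hypothesis dg : forall r : R, 0 < r ->
  is_derive r (1 : R) g (- (2 * f r) - 2 * p * g r / r).

(** The leading energy r^(2p) (f^2 + g^2) has a derivative of relative order
   1 / r, too large to be integrated up to infinity.  The corrector p f g / r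
   cancels that term and leaves E' = O(E / r^2), which the factor exp(|p| / r)
   of H absorbs. *)
Let q := 2 * p.
Let E (r : R) : R :=
  r `^ q * (f r ^+ 2 + g r ^+ 2) + p * (r `^ (q - 1) * (f r * g r)).
Let H (r : R) : R := E r * expR (`|p| * r `^ (-1)).

Let powR_pred (r a : R) : 0 < r -> r `^ a = r * r `^ (a - 1).
Proof.
move=> r0; rewrite -[X in X * _](powRr1 (ltW r0)) -powRD; last first.
  by rewrite (gt_eqF r0) implybT.
by congr (_ `^ _); ring.
Qed.

Let dE (r : R) : 0 < r -> is_derive r (1 : R) E (- p * r `^ (q - 2) * (f r * g r)).
Proof.
move=> r0.
have r0' : r != 0 by rewrite gt_eqF.
have dfr := df r0; have dgr := dg r0.
have dq := is_derive1_powR q r0.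
have dq1 := is_derive1_powR (q - 1) r0.
have d1 := is_deriveM dq (is_deriveD (is_deriveX 2 dfr) (is_deriveX 2 dgr)).
have d2 := is_deriveM dq1 (is_deriveM dfr dgr).
have d4 := is_deriveD d1 (is_deriveZ p d2).
apply: (is_derive_eq d4).
rewrite /GRing.scale/=.
rewrite (powR_pred q r0) (powR_pred (q - 1) r0) {}/q.
have -> : 2 * p - 1 - 1 = 2 * p - 2 by ring.
rewrite !fctE; move: (f r) (g r) (r `^ _) => u v w.
by field.
Qed.

Let dH (r : R) : 0 < r -> is_derive r (1 : R) H
  (- expR (`|p| * r `^ (-1)) * r `^ (q - 2) * (p * (f r * g r) +
     `|p| * (f r ^+ 2 + g r ^+ 2 + p * (f r * g r) / r))).
Proof.
move=> r0.
have r0' : r != 0 by rewrite gt_eqF.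
have d1 := dE r0.
have d2 := is_deriveZ `|p| (is_derive1_powR (-1) r0).
have d3 := is_derive1_comp (is_derive_expR _) d2.
have d4 := is_deriveM d1 d3.
apply: (is_derive_eq d4).
rewrite /GRing.scale/= /E.
have -> : -1 - 1 = -2 :> R by ring.
rewrite (powR_pred q r0) (powR_pred (q - 1) r0).
have -> : q - 1 - 1 = q - 2 by ring.
have -> : r `^ (-2) = r ^- 2 by rewrite -powR_invn// ltW.
move: (f r) (g r) (r `^ (_ - 2)) (expR _) => u v w e.
by field.
Qed.

Let double_mul_le (u v : R) : 2 * `|u * v| <= u ^+ 2 + v ^+ 2.
Proof.
rewrite normrM -[u ^+ 2]real_normK ?num_real// -[v ^+ 2]real_normK ?num_real//.
by have := sqr_ge0 (`|u| - `|v|); lra.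
Qed.

Let H_nincr (r0 r : R) : 0 < r0 -> `|p| <= r0 -> r0 <= r -> H r <= H r0.
Proof.
move=> r0_gt0 pr0 r0r.
have pos x : r0 <= x -> 0 < x by exact: lt_le_trans.
apply: (@ler0_derive1_nincry _ H r0) => //.
- move=> x; rewrite in_itv/= andbT => /ltW/pos x0.
  exact: (ex_derive (is_derive := dH x0)).
- move=> x; rewrite in_itv/= andbT => r0x; have x0 := pos x (ltW r0x).
  rewrite derive1E (derive_val (is_derive := dH x0)) !mulNr oppr_le0.
  rewrite mulr_ge0// ?mulr_ge0 ?expR_ge0 ?powR_ge0//.
  have px : `|p * (f x * g x) / x| <= `|f x * g x|.
    rewrite normrM normfV (gtr0_norm x0) ler_pdivrMr// normrM mulrC.
    by rewrite ler_wpM2l// (le_trans pr0)// ltW.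
  have fg := double_mul_le (f x) (g x).
  have h1 : `|f x * g x| <= f x ^+ 2 + g x ^+ 2 + p * (f x * g x) / x.
    by move: px; rewrite ler_norml => /andP[]; lra.
  have h2 : - (`|p| * `|f x * g x|) <= p * (f x * g x).
    by rewrite -normrM lerNl ler_normr lexx orbT.
  have h3 := ler_wpM2l (normr_ge0 p) h1; lra.
- apply: derivable_within_continuous => x; rewrite in_itv/= andbT => /pos x0.
  exact: (ex_derive (is_derive := dH x0)).
Qed.

(** Beyond r0 >= 2 |p| the corrector is at most half of the leading energy, so
    r^(2p) f^2 <= 2 E <= 2 H, and H is nonincreasing. *)
Lemma sonin_bound : exists C r0, 0 < r0 /\
  forall r, r0 <= r -> `|f r| <= C * r `^ (- p).
Proof.
pose r0 : R := 2 * `|p| + 1.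
have r0_gt0 : 0 < r0 by rewrite ltr_wpDl// mulr_ge0.
have pr0 : `|p| <= r0 by have := normr_ge0 p; rewrite /r0; lra.
exists (Num.sqrt (2 * H r0)), r0; split=> // r r0r.
have r_gt0 : 0 < r by exact: lt_le_trans r0r.
have fE : r `^ q * (f r ^+ 2) <= 2 * E r.
  rewrite /E (powR_pred q r_gt0).
  have w0 : 0 <= r `^ (q - 1) by exact: powR_ge0.
  have fg := double_mul_le (f r) (g r).
  have h1 : - (r * `|f r * g r|) <= 2 * (p * (f r * g r)).
    apply: (@le_trans _ _ (- (2 * `|p| * `|f r * g r|))).
      rewrite lerN2 ler_wpM2r// (le_trans _ r0r)// /r0 lerDl//.
    by rewrite -mulrA -normrM lerNl -mulrN ler_pM2l// ler_normr lexx orbT.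
  have h2 := ler_wpM2l (ltW r_gt0) fg.
  have h3 := mulr_ge0 (ltW r_gt0) (sqr_ge0 (f r)).
  have h4 := mulr_ge0 (ltW r_gt0) (sqr_ge0 (g r)).
  suff : 0 <= r `^ (q - 1) *
    (r * (f r ^+ 2) + 2 * (r * g r ^+ 2) + 2 * (p * (f r * g r))) by lra.
  by apply: mulr_ge0 => //; lra.
have EH : 2 * E r <= 2 * H r0.
  rewrite ler_pM2l//; apply: le_trans (H_nincr r0_gt0 pr0 r0r).
  rewrite /H ler_peMr//.
    have : 0 <= 2 * E r by apply: le_trans fE; rewrite mulr_ge0 ?powR_ge0 ?sqr_ge0.
    by rewrite pmulr_rge0.
  by rewrite -expR0 ler_expR mulr_ge0 ?powR_ge0.
have : r `^ p * `|f r| <= Num.sqrt (2 * H r0).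
  rewrite -[leLHS]ger0_norm ?mulr_ge0 ?powR_ge0// -sqrtr_sqr ler_sqrt; last first.
    by apply: le_trans EH; apply: le_trans fE; rewrite mulr_ge0 ?powR_ge0 ?sqr_ge0.
  rewrite exprMn real_normK ?num_real//; apply: le_trans EH; apply: le_trans fE.
  rewrite ler_wpM2r ?sqr_ge0// -powR_mulrn ?powR_ge0// -powRrM mulrC //.
by rewrite powRN ler_pdivlMr ?powR_gt0// mulrC.
Qed.

End energy.

Section decay.
Context {R : realType}.
Variable (b : R).
Hypothesis b0 : 0 < b.
Let p := b - 2^-1.
Let f (r : R) : R := clifford b (r ^+ 2).
Let g (r : R) : R := - r * clifford (b + 1) (r ^+ 2).

Let df (r : R) : is_derive r (1 : R) f (2 * g r).
Proof.
have d : is_derive (r ^+ 2) (1 : R) (clifford b) (- clifford (b + 1) (r ^+ 2)).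
  exact: is_derive_clifford.
apply: (is_derive_eq (is_derive1_comp _ _)).
by rewrite /g [r%:A]mulr1; ring.
Qed.

Let dg (r : R) : r != 0 -> is_derive r (1 : R) g (- (2 * f r) - 2 * p * g r / r).
Proof.
move=> r0.
have b1 : 0 < b + 1 by rewrite addr_gt0.
have d : is_derive (r ^+ 2) (1 : R) (clifford (b + 1))
    (- clifford (b + 1 + 1) (r ^+ 2)).
  exact: is_derive_clifford.
have d2 : is_derive r (1 : R) (clifford (b + 1) \o (fun r => r ^+ 2))
    (- (2 * r) * clifford (b + 1 + 1) (r ^+ 2)).
  apply: (is_derive_eq (is_derive1_comp _ _)).
  by rewrite [r%:A]mulr1; ring.
have ode := clifford_ode (r ^+ 2) b0.
apply: (@is_derive_eq _ _ _ _ r 1 _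
  (- r *: (- (2 * r) * clifford (b + 1 + 1) (r ^+ 2)) +
   clifford (b + 1) (r ^+ 2) *: (-1))).
  exact: is_deriveM.
transitivity (2 * (r ^+ 2 * clifford (b + 1 + 1) (r ^+ 2)) -
  clifford (b + 1) (r ^+ 2)).
  move: (clifford _ _) (clifford _ _) => u v; rewrite /GRing.scale/=; ring.
rewrite ode.
rewrite /g /f /p; move: (clifford _ _) (clifford _ _) => u v; field.
exact: r0.
Qed.

Lemma clifford_decay : exists C r0, 0 < r0 /\
  forall r, r0 <= r -> `|clifford b (r ^+ 2)| <= C * r `^ (2^-1 - b).
Proof.
have [|C [r0 [r0_gt0 h]]] := @sonin_bound R p f g (fun r _ => df r).
  by move=> r r_gt0; apply: dg; rewrite gt_eqF.
by exists C, r0; split=> // r /h; rewrite /f /p opprB.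
Qed.

End decay.

(** * Laplace transform of the Bessel-Clifford series *)

Section termwise.
Context {R : realType}.
Notation leb := (@lebesgue_measure R).
Variables (b s : R).
Hypothesis b0 : 0 < b.
Let c := clifford_coef b.
(** The m-th term of t^(b-1) e^(-t) F_b(s t). *)
Let h (m : nat) (t : R) : \bar R := (c m * s ^+ m * gamma_fun (m%:R + b) t)%:E.
Let D : set R := `]0, +oo[.
Let mD : measurable D. Proof. exact: measurable_itv. Qed.
Let mb m : 0 < m%:R + b. Proof. by rewrite ltr_wpDl. Qed.

Let gamma_funD m (t : R) : 0 < t -> gamma_fun (m%:R + b) t = gamma_fun b t * t ^+ m.
Proof.
move=> t0; rewrite /gamma_fun mulrAC -powR_mulrn ?ltW// -powRD; last first.
  by rewrite (gt_eqF t0) implybT.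
by congr (_ `^ _ * _); ring.
Qed.

Let int_h m : leb.-integrable D (h m).
Proof.
rewrite (_ : h m = fun t => ((c m * s ^+ m)%:E * (gamma_fun (m%:R + b) t)%:E)%E)//.
by apply: integrableZl (integrable_gamma_fun (mb m)).
Qed.

Let integral_h m : (\int[leb]_(t in D) h m t = (exp_coeff (- s) m)%:E)%E.
Proof.
rewrite (_ : h m = fun t => ((c m * s ^+ m)%:E * (gamma_fun (m%:R + b) t)%:E)%E)//.
rewrite integralZl//; last exact: integrable_gamma_fun (mb m).
rewrite integral_gamma_fun// -EFinM /exp_coeff/= /c /clifford_coef [(- s) ^+ m]exprNn.
have g0 : Gamma (m%:R + b) != 0 by rewrite gt_eqF// Gamma_gt0.
have f0 : m`!%:R != 0 :> R by rewrite pnatr_eq0 -lt0n fact_gt0.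
by congr (_%:E); field; rewrite f0.
Qed.

Let integral_abs_h m : (\int[leb]_(t in D) `|h m t| = (exp_coeff `|s| m)%:E)%E.
Proof.
transitivity (\int[leb]_(t in D) (`|c m * s ^+ m|%:E * (gamma_fun (m%:R + b) t)%:E))%E.
  apply: eq_integral => t _; rewrite /h /= normrM -EFinM.
  by rewrite [X in _ * X]ger0_norm// gamma_fun_ge0.
rewrite integralZl//; last exact: integrable_gamma_fun (mb m).
rewrite integral_gamma_fun// -EFinM /exp_coeff/= normrM normrX clifford_coef_norm// invfM.
congr (_%:E).
have g0 : Gamma (m%:R + b) != 0 by rewrite gt_eqF// Gamma_gt0.
by rewrite mulrAC divfK// mulrC.
Qed.

(** The absolute values of the terms integrate to sum_m |s|^m / m! < oo, so
   their sum is a majorant of the partial sums. *)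
Let dom (t : R) : \bar R := (\sum_(m <oo) `|h m t|)%E.

Let int_dom : leb.-integrable D dom.
Proof.
have mh m : measurable_fun D (fun t => `|h m t|%E).
  by apply: measurableT_comp => //; exact: measurable_int (int_h m).
apply/integrableP; split.
  by apply: (@ge0_emeasurable_sum _ _ _ D (fun m t => `|h m t|%E) xpredT).
under eq_integral => t _.
  rewrite gee0_abs; last by apply: nneseries_ge0.
  over.
rewrite integral_nneseries//.
under eq_eseriesr do rewrite integral_abs_h.
rewrite -[ltLHS]/(limn _).
have -> : (fun n => \sum_(0 <= i < n) (exp_coeff `|s| i)%:E)%E =
    EFin \o series (exp_coeff `|s|).
  by apply/funext => n; rewrite /= sumEFin.
by rewrite EFin_lim ?ltry//; exact: is_cvg_series_exp_coeff.
Qed.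

Let gamma_clifford :
  leb.-integrable D (fun t => (gamma_fun b t * clifford b (s * t))%:E) /\
  (\int[leb]_(t in D) (gamma_fun b t * clifford b (s * t))%:E =
   (expR (- s))%:E)%E.
Proof.
pose f_ n t : \bar R := (\sum_(m < n) h m t)%E.
have f_E n t : D t -> f_ n t = (gamma_fun b t * pseries c (s * t) n)%:E.
  rewrite /D/= in_itv/= andbT => t0.
  rewrite /f_ /pseries /series/= mulr_sumr -sumEFin big_mkord.
  apply: eq_bigr => m _; rewrite /h gamma_funD// exprMn; congr (_%:E); ring.
have mf n : measurable_fun D (f_ n).
  by apply: emeasurable_sum => m; exact: measurable_int (int_h m).
have f_cvg t : D t -> f_ n t @[n --> \oo] --> (gamma_fun b t * clifford b (s * t))%:E.
  move=> Dt; under eq_fun do rewrite f_E//.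
  apply: cvg_EFin; first exact: nearW.
  by apply: cvgMl_tmp; exact: is_cvg_clifford.
have mlim : measurable_fun D (fun t => (gamma_fun b t * clifford b (s * t))%:E).
  exact: emeasurable_fun_cvg mf f_cvg.
have [] := @dominated_convergence _ _ _ leb D _ f_
  (fun t => (gamma_fun b t * clifford b (s * t))%:E) dom mf mlim _ int_dom _ => //.
- by apply: aeW => t; exact: f_cvg.
- apply: aeW => t n Dt.
  apply: (@le_trans _ _ (\sum_(m < n) `|h m t|)%E); first exact: lee_abs_sum.
  by rewrite -(big_mkord xpredT (fun m => `|h m t|%E)); apply: nneseries_lim_ge.
move=> ioo _ cf; split=> //.
have c2 : (fun n => \int[leb]_(t in D) f_ n t)%E @ \oo --> (expR (- s))%:E.
  have -> : (fun n => \int[leb]_(t in D) f_ n t)%E = EFin \o series (exp_coeff (- s)).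
    apply/funext => n; rewrite /f_ integral_sum//= /series/= big_mkord -sumEFin.
    by apply: eq_bigr => m _; rewrite integral_h.
  by apply: cvg_EFin; [exact: nearW|exact: is_cvg_series_exp_coeff].
exact: (cvg_unique _ cf c2).
Qed.

Lemma integrable_gamma_clifford : leb.-integrable `]0%R, +oo[
  (fun t => (gamma_fun b t * clifford b (s * t))%:E).
Proof. exact: gamma_clifford.1. Qed.

(** The integral of t^(m+b-1) e^(-t) is Gamma(m + b), which cancels the
    denominator of the m-th coefficient and leaves the exponential series. *)
Lemma integral_gamma_clifford :
  (\int[leb]_(t in `]0%R, +oo[) (gamma_fun b t * clifford b (s * t))%:E =
   (expR (- s))%:E)%E.
Proof. exact: gamma_clifford.2. Qed.

End termwise.

(** * The function e^(nu) *)

Section evec.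
Context {R : realType}.

Lemma besselJE (alpha z : R) : - 1 < alpha -> 0 < z ->
  besselJ alpha z = (z / 2) `^ alpha * clifford (alpha + 1) ((z / 2) ^+ 2).
Proof.
move=> a1 z0; have b0 : 0 < alpha + 1 by lra.
have z2 : 0 < z / 2 by rewrite divr_gt0.
rewrite /besselJ /clifford -[RHS]/(_ *: _) -lim_seriesZ; last exact: is_cvg_clifford.
congr (limn (series _)); apply/funext => m.
rewrite -[RHS]/(_ * (_ * _)) /clifford_coef addrA powRD; last first.
  by rewrite (gt_eqF z2) implybT.
by rewrite (powR_mulrn _ (ltW z2)) -mul2n exprM [LHS]mulrA [LHS]mulrC.
Qed.

Variable nu : R.
Hypothesis nu0 : 0 < nu.
Let N := nu + 2.
Let N0 : 0 < N. Proof. by rewrite addr_gt0. Qed.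

Definition evec_arg (x : R) : R := `|x| `^ (nu + 2) / (nu + 2) ^+ 2.

Definition evec_re (x : R) : R :=
  Gamma (1 / (nu + 2)) * clifford (1 / (nu + 2)) (evec_arg x).

Definition evec_im_cst : R :=
  Gamma (1 / (nu + 2)) * (nu + 2) `^ (- (2 * ((nu + 1) / (nu + 2)))).

Definition evec_im (x : R) : R :=
  evec_im_cst * (x * `|x| `^ nu * clifford ((nu + 1) / (nu + 2) + 1) (evec_arg x)).

Let halfarg (x : R) : `|x| `^ (nu / 2 + 1) / (nu / 2 + 1) / 2 = `|x| `^ (N / 2) / N.
Proof.
have -> : N / 2 = nu / 2 + 1 by rewrite /N; field.
have e : nu / 2 + 1 = N / 2 by rewrite /N; field.
rewrite -mulrA -invfM e divfK//.
Qed.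

Let halfarg_sqr (x : R) : (`|x| `^ (N / 2) / N) ^+ 2 = evec_arg x.
Proof.
rewrite expr_div_n -powR_mulrn ?powR_ge0// -powRrM divfK//.
Qed.

(** The powers of |x| in the prefactor of e^(nu) cancel the factor
    (z / 2)^(-alpha) of J_(-alpha), and add up to |x|^(nu+1) with the factor
    (z / 2)^alpha of J_alpha. *)
Lemma evecE x : evec nu x = (evec_re x +i* evec_im x)%C.
Proof.
rewrite /evec; case: eqVneq => [->|x0].
  rewrite /evec_im mul0r mul0r mulr0 /evec_re /evec_arg normr0 powR0 ?gt_eqF// mul0r.
  rewrite clifford0.
  by rewrite mulfV// gt_eqF// Gamma_gt0// divr_gt0.
have x_gt0 : 0 < `|x| by rewrite normr_gt0.
set al := (nu + 1) / (nu + 2).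
have al0 : 0 < al by rewrite divr_gt0// addr_gt0.
have al1 : al < 1 by rewrite ltr_pdivrMr// mul1r ltrD2l ltr1n.
have z0 : 0 < `|x| `^ (nu / 2 + 1) / (nu / 2 + 1).
  by rewrite divr_gt0 ?powR_gt0// addr_gt0// divr_gt0.
rewrite !besselJE//; [|lra..].
rewrite halfarg halfarg_sqr.
have alE : N / 2 * al = (nu + 1) / 2 by rewrite /N /al; field; rewrite gt_eqF.
have pw (c : R) : (`|x| `^ (N / 2) / N) `^ (c * al) =
    `|x| `^ (c * ((nu + 1) / 2)) * N `^ (- (c * al)).
  rewrite powRM ?powR_ge0 ?invr_ge0 ?ltW// -powRrM mulrCA alE.
  by rewrite -(powR_inv1 (ltW N0)) -powRrM mulN1r.
have := pw (- 1); rewrite !mulN1r opprK => ->.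
have := pw 1; rewrite !mul1r => ->.
have alN : - al + 1 = 1 / (nu + 2).
  by rewrite /al; field; rewrite gt_eqF.
rewrite alN; set A := clifford _ _; set B := clifford _ _.
rewrite /evec_re /evec_im -/al -/A -/B /u_ -/N -/al /evec_im_cst -/N -/al.
set G := Gamma _; set h := (nu + 1) / 2.
have e1 : `|x| `^ h * `|x| `^ (- h) = 1.
  by rewrite powRN mulfV// gt_eqF// powR_gt0.
have e2 : N `^ (- al) * N `^ al = 1.
  by rewrite powRN mulVf// gt_eqF// powR_gt0.
have e3 : N `^ (- (2 * al)) = N `^ (- al) * N `^ (- al).
  rewrite -powRD; first by congr (_ `^ _); ring.
  by rewrite (gt_eqF N0) implybT.
have e4 : Num.sg x * (`|x| `^ h * `|x| `^ h) = x * `|x| `^ nu.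
  rewrite -powRD; last by rewrite (gt_eqF x_gt0) implybT.
  have -> : h + h = 1 + nu by rewrite /h; field.
  rewrite powRD; last by rewrite (gt_eqF x_gt0) implybT.
  by rewrite powRr1// mulrA -numEsg.
rewrite e3 -e4.
move: e1 e2; move: (`|x| `^ h) (`|x| `^ (- h)) (N `^ al) (N `^ (- al)) (Num.sg x).
move=> p p' n' n s e1 e2.
apply/eqP; rewrite eq_complex /=; apply/andP; split; apply/eqP.
  transitivity ((p * p') * (n * n') * (G * A)); last by rewrite e1 e2 !mul1r.
  by ring.
by ring.
Qed.

(** Here |x|^(N/2) / N plays the role of the variable r of [clifford_decay]:
    where r is large, that lemma gives the power of |x|; where r is bounded,
    so is x. *)
Lemma evec_bound_aux (b k : R) : 0 < b -> 0 <= k ->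
  exists2 C, 0 <= C & forall x, `| `|x| `^ k * clifford b (evec_arg x)| <=
    C * (1 + `|x| `^ (k + (2^-1 - b) * (N / 2))).
Proof.
move=> b0 k0.
have [C [r0 [r0_gt0 hC]]] := clifford_decay b0.
pose X := (N * r0) `^ (2 / N).
exists (`|C * N `^ (b - 2^-1)| + X `^ k * (clifford_bound b * expR (r0 ^+ 2))).
  by rewrite addr_ge0// mulr_ge0 ?powR_ge0// mulr_ge0 ?expR_ge0// clifford_bound_ge0.
move=> x; set th := k + _.
have c2 : 0 <= X `^ k * (clifford_bound b * expR (r0 ^+ 2)).
  by rewrite mulr_ge0 ?powR_ge0// mulr_ge0 ?expR_ge0// clifford_bound_ge0.
have [rx|rx] := leP r0 (`|x| `^ (N / 2) / N).
  have x_gt0 : 0 < `|x|.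
    rewrite lt_neqAle normr_ge0 andbT eq_sym; apply/eqP => xz; move: rx.
    by rewrite xz powR0 ?mul0r ?leNgt ?r0_gt0// gt_eqF// divr_gt0.
  have := hC _ rx; rewrite halfarg_sqr => hx.
  rewrite normrM ger0_norm ?powR_ge0//.
  apply: (@le_trans _ _ (`|C * N `^ (b - 2^-1)| * `|x| `^ th)).
    apply: (@le_trans _ _ (`|x| `^ k * (C * (`|x| `^ (N / 2) / N) `^ (2^-1 - b)))).
      by rewrite ler_wpM2l ?powR_ge0.
    have Ni : 0 <= N^-1 by rewrite invr_ge0 ltW.
    rewrite powRM ?powR_ge0// -powRrM -(powR_inv1 (ltW N0)) -powRrM.
    rewrite mulN1r opprB.
    have -> : `|x| `^ th = `|x| `^ k * `|x| `^ (N / 2 * (2^-1 - b)).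
      by rewrite -powRD ?(gt_eqF x_gt0) ?implybT// /th [(2^-1 - b) * _]mulrC.
    rewrite [leRHS]mulrCA; apply: ler_wpM2l; first exact: powR_ge0.
    rewrite mulrCA mulrC; apply: ler_wpM2r; first exact: powR_ge0.
    by rewrite ler_norm.
  rewrite mulrDl; apply: ler_wpDr.
    by apply: mulr_ge0 => //; rewrite addr_ge0 ?powR_ge0.
  by apply: ler_wpM2l => //; rewrite lerDr.
have x_le : `|x| <= X.
  have e1 : N / 2 * (2 / N) = 1 by field; rewrite gt_eqF.
  rewrite [leLHS](_ : _ = (`|x| `^ (N / 2)) `^ (2 / N)); last first.
    by rewrite -powRrM e1 powRr1.
  rewrite /X; apply: ge0_ler_powR.
  - by rewrite divr_ge0// ltW.
  - by rewrite nnegrE powR_ge0.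
  - by rewrite nnegrE mulr_ge0// ltW.
  - by rewrite [leRHS]mulrC -ler_pdivrMr//; exact: ltW.
rewrite normrM ger0_norm ?powR_ge0//.
apply: (@le_trans _ _ (X `^ k * (clifford_bound b * expR (r0 ^+ 2)))).
  apply: ler_pM; rewrite ?powR_ge0//.
    by apply: ge0_ler_powR => //; rewrite nnegrE ?powR_ge0.
  apply: (le_trans (clifford_le_exp _ b0)).
  rewrite ler_wpM2l ?clifford_bound_ge0// ler_expR -halfarg_sqr.
  rewrite ger0_norm ?sqr_ge0//; apply: lerXn2r; rewrite ?nnegrE; [|exact: ltW..].
  by rewrite divr_ge0 ?powR_ge0// ltW.
rewrite mulrDl -[leLHS]add0r; apply: lerD; first by rewrite mulr_ge0// addr_ge0 ?powR_ge0.
by rewrite ler_peMr// lerDl powR_ge0.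
Qed.

Lemma evec_re_bound : exists2 C, 0 <= C &
  forall x, `|evec_re x| <= C * (1 + `|x| `^ (nu / 4)).
Proof.
have b0 : 0 < 1 / N by rewrite divr_gt0.
have [C C0 hC] := evec_bound_aux b0 (lexx 0).
exists (Gamma (1 / N) * C); first by rewrite mulr_ge0// ltW// Gamma_gt0.
move=> x; rewrite normrM gtr0_norm ?Gamma_gt0// -mulrA ler_wpM2l//.
  by rewrite ltW// Gamma_gt0.
have := hC x; rewrite powRr0 mul1r.
have -> // : 0 + (2^-1 - 1 / N) * (N / 2) = nu / 4.
by rewrite /N; field; rewrite gt_eqF.
Qed.

Lemma evec_im_bound : exists2 C, 0 <= C &
  forall x, `|evec_im x| <= C * (1 + `|x| `^ (nu / 4)).
Proof.
have b0 : 0 < (nu + 1) / N + 1 by rewrite addr_gt0// divr_gt0// addr_gt0.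
have k0 : 0 <= nu + 1 by rewrite addr_ge0// ltW.
have [C C0 hC] := evec_bound_aux b0 k0.
exists (`|evec_im_cst| * C); first by rewrite mulr_ge0.
move=> x; rewrite /evec_im normrM -[leRHS]mulrA ler_wpM2l//.
have := hC x.
have -> : nu + 1 + (2^-1 - ((nu + 1) / N + 1)) * (N / 2) = nu / 4.
  by rewrite /N; field; rewrite gt_eqF.
apply: le_trans; rewrite !normrM ler_wpM2r// -normrM.
have [->|x0] := eqVneq x 0; first by rewrite mul0r normr0.
rewrite normrM [`|x| `^ (nu + 1)]powRD ?normr_eq0 ?x0 ?implybT//.
by rewrite powRr1// mulrC normrM normr_id.
Qed.

End evec.

(** * Mixtures of dilations *)

Section mixing.
(** The function e grows at most like 1 + |x|^th, and it is dilated by the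
    factor Q t, where t is distributed with the weight w. *)
Context {R : realType}.
Notation leb := (@lebesgue_measure R).
Variables (th C : R) (e w Q : R -> R).
Hypothesis C0 : 0 <= C.
Hypothesis me : measurable_fun setT e.
Hypothesis e_le : forall x, `|e x| <= C * (1 + `|x| `^ th).
Hypotheses (mw : measurable_fun setT w) (mQ : measurable_fun setT Q).
Hypotheses (w0 : forall t, 0 <= w t) (Q0 : forall t, 0 <= Q t).
Hypothesis int_w : leb.-integrable setT (fun t => (w t * (1 + Q t `^ th))%:E).

Let prodmax (a x : R) : 1 + `|a * x| `^ th <= (1 + `|a| `^ th) * (1 + `|x| `^ th).
Proof.
rewrite normrM powRM//.
have := powR_ge0 `|a| th; have := powR_ge0 `|x| th.
by move: (_ `^ _) (_ `^ _) => u v ? ?; rewrite mulrDl mul1r mulrDr mulr1; lra.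
Qed.

Section one_measure.
Variables (m : probability (measurableTypeR R) R) (M : R).
Hypothesis mM : (\int[m]_x (`|x| `^ th)%:E <= M%:E)%E.

Definition transform (q : R) : R := \int[m]_x e (q * x).

Let int_pow : m.-integrable setT (fun x => (1 + `|x| `^ th)%:E).
Proof.
apply: (@integrableD _ _ _ m setT _ (cst 1%:E) (fun x => (`|x| `^ th)%:E)) => //.
- exact: finite_measure_integrable_cst.
- apply/integrableP; split; first by apply/measurable_EFinP; exact: measurable_abs_powR.
  under eq_integral do rewrite gee0_abs ?lee_fin ?powR_ge0//.
  by apply: le_lt_trans mM _; rewrite ltry.
Qed.

Let integral_pow_le : (\int[m]_x (1 + `|x| `^ th)%:E <= (1 + M)%:E)%E.
Proof.
under eq_integral do rewrite EFinD.
rewrite ge0_integralD//.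
- rewrite integral_cst//= mul1e probability_setT EFinD leeD//.
- by apply/measurable_EFinP; exact: measurable_abs_powR.
Qed.

Let e_meas (q : R) : measurable_fun setT (fun x : R => e (q * x)).
Proof. by apply: measurableT_comp => //; exact: measurableT_comp. Qed.

Let e_int (q : R) : m.-integrable setT (fun x : R => (e (q * x))%:E).
Proof.
apply: (@le_integrable _ _ _ m setT _ _
  (fun x => ((C * (1 + `|q| `^ th))%:E * (1 + `|x| `^ th)%:E)%E)) => //.
- by apply/measurable_EFinP; exact: e_meas.
- move=> x _; rewrite -EFinM /= lee_fin [leRHS]ger0_norm; last first.
    by rewrite !mulr_ge0// addr_ge0 ?powR_ge0.
  apply: (le_trans (e_le _)); rewrite -mulrA; apply: ler_wpM2l => //.
- exact: integrableZl.
Qed.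

Lemma transform_le q : `|transform q| <= C * (1 + `|q| `^ th) * (1 + M).
Proof.
rewrite -lee_fin EFin_normr_Rintegral//.
apply: (le_trans (le_abse_integral _ _ _)) => //; first exact: measurable_int (e_int q).
apply: (@le_trans _ _ (\int[m]_x ((C * (1 + `|q| `^ th))%:E * (1 + `|x| `^ th)%:E))%E).
  apply: ge0_le_integral => //.
  - by apply: measurableT_comp => //; exact: measurable_int (e_int q).
  - by apply: measurable_int (integrableZl _ _ int_pow).
  - move=> x _; rewrite /= lee_fin; apply: (le_trans (e_le _)).
    by rewrite -mulrA; apply: ler_wpM2l.
rewrite ge0_integralZl//.
- rewrite [leRHS]EFinM; apply: lee_wpmul2l => //.
  by rewrite lee_fin mulr_ge0// addr_ge0 ?powR_ge0.
- exact: measurable_int int_pow.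
- by rewrite lee_fin mulr_ge0// addr_ge0 ?powR_ge0.
- exact: e_int.
Qed.

(** The integrand of the double integral in (x, t); it is dominated by a
   product of a function of x and a function of t. *)
Let F (z : measurableTypeR R * measurableTypeR R) : \bar R :=
  (w z.2 * e (Q z.2 * z.1))%:E.

Let mF : measurable_fun setT F.
Proof.
apply/measurable_EFinP; apply: measurable_funM.
  exact: measurableT_comp.
apply: measurableT_comp => //; apply: measurable_funM => //.
exact: measurableT_comp.
Qed.

Let F_le (x t : R) :
  (`|F (x, t)| <= (C * (1 + `|x| `^ th))%:E * (w t * (1 + Q t `^ th))%:E)%E.
Proof.
rewrite -EFinM /F /= lee_fin normrM (ger0_norm (w0 t)).
rewrite [leRHS]mulrCA; apply: ler_wpM2l => //.
apply: (le_trans (e_le _)); rewrite -mulrA; apply: ler_wpM2l => //.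
rewrite mulrC -[in leRHS](ger0_norm (Q0 t)) mulrC.
by apply: le_trans (prodmax _ _) _; rewrite mulrC.
Qed.

Let w_tot : R := \int[leb]_t (w t * (1 + Q t `^ th)).

Let w_totE : (\int[leb]_t (w t * (1 + Q t `^ th))%:E = w_tot%:E)%E.
Proof. by rewrite /w_tot /Rintegral fineK//; exact: integrable_fin_num int_w. Qed.

Let w_tot0 : 0 <= w_tot.
Proof. by apply: Rintegral_ge0 => t _; rewrite mulr_ge0// addr_ge0 ?powR_ge0. Qed.

Let intF : (m \x leb)%E.-integrable setT F.
Proof.
apply/integrable12ltyP => //.
apply: (@le_lt_trans _ _ (\int[m]_x ((C * w_tot)%:E * (1 + `|x| `^ th)%:E))%E); last first.
  rewrite ge0_integralZl//; last 2 first.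
  - exact: measurable_int int_pow.
  - by rewrite lee_fin mulr_ge0.
  apply: lte_mul_pinfty => //; first by rewrite lee_fin mulr_ge0.
  by apply: le_lt_trans integral_pow_le _; rewrite ltry.
apply: ge0_le_integral => //.
- by move=> x _; apply: integral_ge0.
- have mFa : measurable_fun setT (abse \o F) by exact: measurableT_comp.
  exact: (measurable_fun_fubini_tonelli_F (abse \o F) mFa (fun=> abse_ge0 _)).
- by apply: measurable_int (integrableZl _ _ int_pow).
move=> x _.
apply: (@le_trans _ _ (\int[leb]_t
  ((C * (1 + `|x| `^ th))%:E * (w t * (1 + Q t `^ th))%:E))%E).
  apply: ge0_le_integral => //.
  - by apply: measurableT_comp => //; apply: (measurableT_comp mF).
  - by apply: measurable_int (integrableZl _ _ int_w).
rewrite ge0_integralZl//.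
- by rewrite w_totE -!EFinM lee_fin mulrAC.
- exact: measurable_int int_w.
- by move=> t _; rewrite lee_fin mulr_ge0// addr_ge0 ?powR_ge0.
- by rewrite lee_fin mulr_ge0// addr_ge0 ?powR_ge0.
Qed.

Let integral_F (t : R) : (\int[m]_x F (x, t) = (w t * transform (Q t))%:E)%E.
Proof.
transitivity (\int[m]_x ((w t)%:E * (e (Q t * x))%:E))%E; first by apply: eq_integral.
rewrite integralZl// EFinM /transform /Rintegral fineK//.
exact: integrable_fin_num (e_int _).
Qed.

Lemma measurable_mix_transform :
  measurable_fun setT (fun t : R => (w t * transform (Q t))%:E).
Proof.
have := measurable_fubini_G intF.
by congr (measurable_fun _ _); apply/funext => t; exact: integral_F.
Qed.

Lemma mix_transformE (K : R -> R) :
  (forall x, \int[leb]_t (w t * e (Q t * x))%:E = (K x)%:E)%E ->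
  (\int[m]_x (K x)%:E = \int[leb]_t (w t * transform (Q t))%:E)%E.
Proof.
move=> hK.
transitivity (\int[m]_x \int[leb]_t F (x, t))%E.
  by apply: eq_integral => x _; rewrite -hK.
by rewrite (Fubini intF); apply: eq_integral => t _; exact: integral_F.
Qed.

Lemma mix_transform_le (t : R) :
  (`|(w t * transform (Q t))%:E| <= (C * (1 + M))%:E * (w t * (1 + Q t `^ th))%:E)%E.
Proof.
rewrite -EFinM /= lee_fin normrM (ger0_norm (w0 t)) [leRHS]mulrCA.
apply: ler_wpM2l => //; apply: le_trans (transform_le _) _.
by rewrite (ger0_norm (Q0 t)) mulrAC.
Qed.

End one_measure.

(** K is the mixture of the dilations of e.  By Fubini's theorem its integral
    against m n is the mixture of the values of the transform, to which
    dominated convergence applies: the bound on moments is uniform in n. *)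
Lemma cvg_integral_mix (m : nat -> probability (measurableTypeR R) R)
    (m_oo : probability (measurableTypeR R) R) (M : R) (K : R -> R) :
  (forall n, \int[m n]_x (`|x| `^ th)%:E <= M%:E)%E ->
  (\int[m_oo]_x (`|x| `^ th)%:E <= M%:E)%E ->
  (forall q, transform (m n) q @[n --> \oo] --> transform m_oo q) ->
  (forall x, \int[leb]_t (w t * e (Q t * x))%:E = (K x)%:E)%E ->
  \int[m n]_x K x @[n --> \oo] --> \int[m_oo]_x K x.
Proof.
move=> hm hmoo hcvg hK.
have dom := integrableZl measurableT (C * (1 + M)) int_w.
have [] := @dominated_convergence _ _ _ leb setT measurableT
  (fun n (t : R) => (w t * transform (m n) (Q t))%:E)
  (fun t : R => (w t * transform m_oo (Q t))%:E)
  (fun t : R => ((C * (1 + M))%:E * (w t * (1 + Q t `^ th))%:E)%E) => //.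
- by move=> n; exact: measurable_mix_transform (hm n).
- exact: measurable_mix_transform hmoo.
- apply: aeW => t _; apply: cvg_EFin; first exact: nearW.
  by apply: cvgMl_tmp; exact: hcvg.
- by apply: aeW => t n _; exact: mix_transform_le (hm n) t.
move=> ioo _ cf; rewrite /Rintegral; apply: fine_cvg.
rewrite (mix_transformE hmoo hK) fineK; last exact: integrable_fin_num ioo.
by under eq_fun => n do rewrite (mix_transformE (hm n) hK).
Qed.

End mixing.

(** * Exponential test functions *)

Section test_functions.
Context {R : realType}.
Notation leb := (@lebesgue_measure R).

Variable nu : R.
Hypothesis nu0 : 0 < nu.
Let N := nu + 2.
Let N0 : 0 < N. Proof. by rewrite addr_gt0. Qed.

Lemma measurable_clifford_arg (b : R) : 0 < b ->
  measurable_fun setT (fun x : R => clifford b (evec_arg nu x)).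
Proof.
move=> b0; apply: measurableT_comp.
  by apply: continuous_measurable_fun; exact: continuous_clifford.
by apply: measurable_funM => //; exact: measurable_abs_powR.
Qed.

Lemma measurable_evec_re : measurable_fun setT (evec_re nu).
Proof.
by apply: measurable_funM => //; apply: measurable_clifford_arg; rewrite divr_gt0.
Qed.

Lemma measurable_evec_im : measurable_fun setT (evec_im nu).
Proof.
apply: measurable_funM => //; apply: measurable_funM.
  by apply: measurable_funM => //; exact: measurable_abs_powR.
by apply: measurable_clifford_arg; rewrite addr_gt0// divr_gt0// addr_gt0.
Qed.

Section weight.
Variables (k beta s : R).
Hypotheses (k0 : 0 <= k) (beta0 : 0 < beta) (s0 : 0 < s).

Definition gamma_weight (t : R) : R :=
  ((fun t => k * gamma_fun beta t) \_ `]0, +oo[) t.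

(** The constant for which the argument |q x|^N / N^2 of the series becomes
    s |x|^N t at q = dilation t; see [evec_arg_dilation]. *)
Definition dilation_cst : R := (s * N ^+ 2) `^ (1 / N).
Definition dilation (t : R) : R := dilation_cst * t `^ (1 / N).

Lemma dilation_ge0 t : 0 <= dilation t.
Proof. by rewrite mulr_ge0 ?powR_ge0. Qed.

Lemma measurable_dilation : measurable_fun setT dilation.
Proof. by apply: measurable_funM => //; exact: measurable_powR. Qed.

Lemma gamma_weight_ge0 t : 0 <= gamma_weight t.
Proof.
by rewrite /gamma_weight patchE; case: ifP => // _; rewrite mulr_ge0 ?gamma_fun_ge0.
Qed.

Lemma measurable_gamma_weight : measurable_fun setT gamma_weight.
Proof.
apply: (measurable_restrictT (fun t => k * gamma_fun beta t) _).1 => //.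
by apply: measurable_funM => //; exact: measurable_gamma_fun.
Qed.

Lemma integral_gamma_weight (h : R -> R) :
  (\int[leb]_t (gamma_weight t * h t)%:E =
   \int[leb]_(t in `]0%R, +oo[) (k * gamma_fun beta t * h t)%:E)%E.
Proof.
rewrite [RHS]integral_mkcond; apply: eq_integral => t _.
by rewrite /gamma_weight !patchE; case: ifP => // _; rewrite mul0r.
Qed.

Lemma integrable_gamma_weight (th : R) : 0 <= th ->
  leb.-integrable setT (fun t : R => (gamma_weight t * (1 + dilation t `^ th))%:E).
Proof.
move=> th0.
have hD : leb.-integrable `]0, +oo[
    (fun t : R => (k * gamma_fun beta t * (1 + dilation t `^ th))%:E).
  have b2 : 0 < beta + 1 / N * th by rewrite ltr_wpDr// mulr_ge0// divr_ge0// ltW.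
  have mD : measurable (`]0, +oo[%classic : set R) by exact: measurable_itv.
  have h1 : leb.-integrable `]0, +oo[ (fun t => (k%:E * (gamma_fun beta t)%:E)%E).
    exact: integrableZl (integrable_gamma_fun beta0).
  have h2 : leb.-integrable `]0, +oo[ (fun t => ((k * dilation_cst `^ th)%:E *
      (gamma_fun (beta + 1 / N * th) t)%:E)%E).
    exact: integrableZl (integrable_gamma_fun b2).
  apply: eq_integrable (integrableD _ h1 h2) => //.
  move=> t /set_mem; rewrite /= in_itv/= andbT => t0.
  rewrite -!EFinM -EFinD; congr (_%:E).
  rewrite /dilation powRM ?powR_ge0// -powRrM /gamma_fun.
  have -> : t `^ (beta + 1 / N * th - 1) = t `^ (beta - 1) * t `^ (1 / N * th).
    rewrite -powRD; first by congr (_ `^ _); ring.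
    by rewrite (gt_eqF t0) implybT.
  by ring.
have := (integrable_mkcond _ _).1 hD.
move=> /(_ (measurable_itv _)); apply: eq_integrable => // t _.
by rewrite /gamma_weight !patchE; case: ifP => // _; rewrite mul0r.
Qed.

Lemma evec_arg_dilation (t x : R) : 0 < t ->
  evec_arg nu (dilation t * x) = s * `|x| `^ N * t.
Proof.
move=> t0.
have sN : 0 <= s * N ^+ 2 by rewrite mulr_ge0 ?sqr_ge0// ltW.
rewrite /evec_arg -/N normrM powRM// (ger0_norm (dilation_ge0 t)).
rewrite /dilation powRM ?powR_ge0// /dilation_cst -!powRrM.
have -> : 1 / N * N = 1 by rewrite divfK// gt_eqF.
rewrite powRr1// powRr1; last exact: ltW.
field; rewrite -/N.
by rewrite gt_eqF.
Qed.

Lemma dilation_cst_gt0 : 0 < dilation_cst.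
Proof. by rewrite powR_gt0// mulr_gt0// exprn_gt0. Qed.

End weight.

(** The weight t^(1/N - 1) e^(-t) is the one of [integral_gamma_clifford] for
    the real part, where b = 1/N. *)
Lemma integral_even_weight (s x : R) : 0 < s ->
  (\int[leb]_t (gamma_weight (Gamma (1 / N))^-1 (1 / N) t *
     evec_re nu (dilation s t * x))%:E = (expR (- (s * `|x| `^ N)))%:E)%E.
Proof.
move=> s0; have a0 : 0 < 1 / N by rewrite divr_gt0.
rewrite integral_gamma_weight -(integral_gamma_clifford (s * `|x| `^ N) a0).
apply: eq_integral => t /set_mem; rewrite /= in_itv/= andbT => t0.
rewrite /evec_re evec_arg_dilation// -/N; congr (_%:E).
have g0 : Gamma (1 / N) != 0 by rewrite gt_eqF// Gamma_gt0.
by rewrite mulrACA mulVf// -[RHS]mul1r.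
Qed.

Let b' := (nu + 1) / N + 1.

Lemma evec_im_cst_gt0 : 0 < evec_im_cst nu.
Proof. by rewrite mulr_gt0 ?powR_gt0// Gamma_gt0// divr_gt0. Qed.

(** Dilating the prefactor x |x|^nu of the imaginary part by q = c t^(1/N)
    produces, up to the factor c^(nu+1), the power t^((nu+1)/N) = t^(b-1) with
    b = (nu+1)/N + 1: the weight e^(-t) leads to [integral_gamma_clifford]. *)
Lemma integral_odd_weight (s x : R) : 0 < s ->
  (\int[leb]_t (gamma_weight (evec_im_cst nu * dilation_cst s `^ (nu + 1))^-1 1 t *
     evec_im nu (dilation s t * x))%:E =
   (x * `|x| `^ nu * expR (- (s * `|x| `^ N)))%:E)%E.
Proof.
move=> s0; have b0 : 0 < b' by rewrite addr_gt0// divr_gt0// addr_gt0.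
rewrite integral_gamma_weight EFinM -(integral_gamma_clifford (s * `|x| `^ N) b0).
rewrite -integralZl//; last exact: integrable_gamma_clifford.
apply: eq_integral => t /set_mem; rewrite /= in_itv/= andbT => t0.
rewrite -EFinM /evec_im evec_arg_dilation// -/N -/b'; congr (_%:E).
have c0 := dilation_cst_gt0 s0.
have e0 : evec_im_cst nu != 0 by rewrite gt_eqF// evec_im_cst_gt0.
have d0 : dilation_cst s `^ (nu + 1) != 0 by rewrite gt_eqF// powR_gt0.
have -> : gamma_fun b' t = gamma_fun 1 t * t `^ (1 / N * (nu + 1)).
  rewrite /gamma_fun subrr powRr0 mul1r mulrC; congr (_ * _ `^ _).
  by rewrite /b'; field; rewrite gt_eqF.
have dE : dilation s t * `|dilation s t * x| `^ nu =
    dilation_cst s `^ (nu + 1) * t `^ (1 / N * (nu + 1)) * `|x| `^ nu.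
  have dp : 0 < dilation s t by rewrite mulr_gt0// powR_gt0.
  rewrite normrM powRM// (ger0_norm (ltW dp)) mulrA; congr (_ * _).
  rewrite powRrM -powRM ?powR_ge0// -/(dilation s t) addrC powRD; last first.
    by rewrite (gt_eqF dp) implybT.
  by rewrite powRr1// ltW.
rewrite (mulrAC (dilation s t) x) dE.
move: (clifford _ _) (gamma_fun _ _) (t `^ _) (`|x| `^ nu) => u v p q.
by field; rewrite e0 d0.
Qed.

Section convergence.
Variables (m : nat -> probability (measurableTypeR R) R)
  (m_oo : probability (measurableTypeR R) R) (M : R).
Hypothesis hm : (forall n, \int[m n]_x (`|x| `^ (nu / 4))%:E <= M%:E)%E.
Hypothesis hm_oo : (\int[m_oo]_x (`|x| `^ (nu / 4))%:E <= M%:E)%E.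

Let th0 : 0 <= nu / 4. Proof. by rewrite divr_ge0// ltW. Qed.

Lemma cvg_integral_even (s : R) : 0 < s ->
  (forall q, transform (evec_re nu) (m n) q @[n --> \oo] -->
             transform (evec_re nu) m_oo q) ->
  \int[m n]_x expR (- (s * `|x| `^ N)) @[n --> \oo] -->
  \int[m_oo]_x expR (- (s * `|x| `^ N)).
Proof.
move=> s0 hcvg; have a0 : 0 < 1 / N by rewrite divr_gt0.
have g0 : 0 <= (Gamma (1 / N))^-1 by rewrite invr_ge0 ltW// Gamma_gt0.
have [C C0 hC] := evec_re_bound nu0.
apply: (@cvg_integral_mix R (nu / 4) C (evec_re nu)
  (gamma_weight ((Gamma (1 / N))^-1) (1 / N)) (dilation s)
  C0 _ hC _ _ _ _ _ m m_oo M _ hm hm_oo hcvg).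
- exact: measurable_evec_re.
- exact: measurable_gamma_weight.
- exact: measurable_dilation.
- by move=> t; exact: gamma_weight_ge0.
- by move=> t; exact: dilation_ge0.
- exact: integrable_gamma_weight.
- by move=> x; exact: integral_even_weight.
Qed.

Lemma cvg_integral_odd (s : R) : 0 < s ->
  (forall q, transform (evec_im nu) (m n) q @[n --> \oo] -->
             transform (evec_im nu) m_oo q) ->
  \int[m n]_x (x * `|x| `^ nu * expR (- (s * `|x| `^ N))) @[n --> \oo] -->
  \int[m_oo]_x (x * `|x| `^ nu * expR (- (s * `|x| `^ N))).
Proof.
move=> s0 hcvg.
have g0 : 0 <= (evec_im_cst nu * dilation_cst s `^ (nu + 1))^-1.
  by rewrite invr_ge0 mulr_ge0 ?powR_ge0// ltW// evec_im_cst_gt0.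
have [C C0 hC] := evec_im_bound nu0.
apply: (@cvg_integral_mix R (nu / 4) C (evec_im nu)
  (gamma_weight ((evec_im_cst nu * dilation_cst s `^ (nu + 1))^-1) 1) (dilation s)
  C0 _ hC _ _ _ _ _ m m_oo M _ hm hm_oo hcvg).
- exact: measurable_evec_im.
- exact: measurable_gamma_weight.
- exact: measurable_dilation.
- by move=> t; exact: gamma_weight_ge0.
- by move=> t; exact: dilation_ge0.
- exact: integrable_gamma_weight.
- by move=> x; exact: integral_odd_weight.
Qed.

End convergence.
End test_functions.

(** * Uniform approximation by polynomials *)

Section weierstrass.
Context {R : realType}.

(** The n-th Bernstein operator, the expectation of f(k) for k a sum of n
    independent Bernoulli variables of parameter X, defined by conditioning on
    one of the variables.  This form yields monotonicity and the second moment
    by induction, without binomial identities. *)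
Fixpoint bernstein (n : nat) (f : nat -> R) : {poly R} :=
  if n is n'.+1 then
    'X * bernstein n' (fun k => f k.+1) + (1 - 'X) * bernstein n' f
  else (f 0%N)%:P.

Lemma bernstein_le n (f g : nat -> R) y : 0 <= y <= 1 ->
  (forall k, f k <= g k) -> (bernstein n f).[y] <= (bernstein n g).[y].
Proof.
move=> /andP[y0 y1]; elim: n f g => [|n IH] f g fg /=; first by rewrite !hornerC.
rewrite !(hornerE, hornerM); apply: lerD.
  by apply: ler_wpM2l => //; apply: IH => k; exact: fg.
by apply: ler_wpM2l; [rewrite subr_ge0|exact: IH].
Qed.

(** The variance of k is n y (1 - y), and its mean is n y. *)
Lemma bernstein_quadratic n u A a y :
  (bernstein n (fun k => u + A * (k%:R - a) ^+ 2)).[y] =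
  u + A * (n%:R * y * (1 - y) + (n%:R * y - a) ^+ 2).
Proof.
elim: n a => [|n IH] a /=; first by rewrite hornerC; ring.
have -> : (fun k => u + A * (k.+1%:R - a) ^+ 2) =
    (fun k => u + A * (k%:R - (a - 1)) ^+ 2).
  by apply/funext => k; rewrite -natr1; ring.
by rewrite !(hornerE, hornerM) !IH -natr1; ring.
Qed.

Lemma heine_unit (G : R -> R) (eps : R) : continuous G -> 0 < eps ->
  exists2 d : R, 0 < d & forall y z, 0 <= y <= 1 -> `|z - y| < d -> `|G z - G y| <= eps.
Proof.
move=> cG eps0.
have /compact_near_coveringP cov := @segment_compact R 0 1.
pose P (d y : R) := forall z, `|z - y| < d -> `|G z - G y| <= eps.
have H : \forall d \near (0 : R)^'+, `[0, 1] `<=` P d.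
  apply: cov => y _.
  have e2 : 0 < eps / 2 by rewrite divr_gt0.
  have /cvgrPdist_lt/(_ _ e2) := cG y.
  move=> /nbhs_ballP[r /= r0 hr].
  have r2 : 0 < r / 2 by rewrite divr_gt0.
  near=> y' d => z /= zd.
  have yy' : `|y - y'| < r / 2.
    by near: y'; apply/nbhs_ballP; exists (r / 2).
  have dr : d < r / 2 by near: d; exact: nbhs_right_lt.
  have h1 : `|G y - G y'| < eps / 2 by apply: hr; rewrite /ball/=; lra.
  have h2 : `|G y - G z| < eps / 2.
    apply: hr; rewrite /ball/= -(subrK y' y) -addrA.
    by apply: (le_lt_trans (ler_normD _ _)); rewrite [`|y' - z|]distrC; lra.
  rewrite -(subrK (G y) (G z)) -addrA; apply: (le_trans (ler_normD _ _)).
  by rewrite distrC; lra.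
near (0 : R)^'+ => d.
exists d => // y z y01; apply: (near H d) => //=.
Unshelve. all: by end_near. Qed.

(** Bernstein's proof: |G(k / n) - G(y)| is small when k / n is close to y, and
    at most 2 M ((k / n - y) / d)^2 otherwise; the expectation of the latter is
    O(1 / n) by the variance formula. *)
Lemma weierstrass_unit (G : R -> R) (M eps : R) : continuous G ->
  (forall y, `|G y| <= M) -> 0 < eps ->
  exists p : {poly R}, forall y, 0 <= y <= 1 -> `|G y - p.[y]| <= eps.
Proof.
move=> cG GM eps0; have e2 : 0 < eps / 2 by rewrite divr_gt0.
have M0 : 0 <= M by apply: le_trans (GM 0).
have [d d0 hd] := heine_unit cG e2.
pose B := 2 * M / d ^+ 2.
have B0 : 0 <= B by rewrite divr_ge0 ?sqr_ge0// mulr_ge0.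
have c0 : 0 <= 2 * B / eps by apply: divr_ge0; [exact: mulr_ge0|exact: ltW].
have [n hn] : exists n : nat, 2 * B / eps < n%:R.
  by exists (Num.Def.archi_bound (2 * B / eps)); exact: archi_boundP.
have n0 : 0 < n%:R :> R by exact: le_lt_trans hn.
exists (bernstein n (fun k => G (k%:R / n%:R))) => y y01.
have y2 : y * (1 - y) <= 1 by move/andP: y01 => [? ?]; nra.
have key (k : nat) : `|G (k%:R / n%:R) - G y| <=
    eps / 2 + B / n%:R ^+ 2 * (k%:R - n%:R * y) ^+ 2.
  have E : B / n%:R ^+ 2 * (k%:R - n%:R * y) ^+ 2 = B * (k%:R / n%:R - y) ^+ 2.
    by field; rewrite gt_eqF.
  rewrite E; have [kd|kd] := ltP `|k%:R / n%:R - y| d.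
    apply: (le_trans (hd _ _ y01 kd)); rewrite lerDl mulr_ge0 ?sqr_ge0//.
  apply: (@le_trans _ _ (2 * M)).
    by apply: (le_trans (ler_normB _ _)); have := GM y; have := GM (k%:R / n%:R); lra.
  apply: (@le_trans _ _ (B * (k%:R / n%:R - y) ^+ 2)); last by rewrite lerDr ltW.
  rewrite /B -[leRHS]mulrA -[leLHS]mulr1; apply: ler_wpM2l; first by rewrite mulr_ge0.
  rewrite [leRHS]mulrC ler_pdivlMr ?exprn_gt0// mul1r -[leRHS]real_normK ?num_real//.
  by rewrite lerXn2r ?nnegrE// ltW.
have bound : B / n%:R ^+ 2 *
    (n%:R * y * (1 - y) + (n%:R * y - n%:R * y) ^+ 2) <= eps / 2.
  have -> : B / n%:R ^+ 2 * (n%:R * y * (1 - y) + (n%:R * y - n%:R * y) ^+ 2) =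
      B / n%:R * (y * (1 - y)).
    by field; rewrite gt_eqF.
  apply: (@le_trans _ _ (B / n%:R)).
    by rewrite -[leRHS]mulr1 ler_wpM2l// divr_ge0// ltW.
  rewrite ler_pdivrMr//; move: hn; rewrite ltr_pdivrMr//; lra.
have u1 : (bernstein n (fun k => G (k%:R / n%:R))).[y] <=
    (bernstein n (fun k => G y + eps / 2 +
       B / n%:R ^+ 2 * (k%:R - n%:R * y) ^+ 2)).[y].
  by apply: bernstein_le => // k; have := key k; rewrite ler_norml => /andP[]; lra.
have u2 : (bernstein n (fun k => G y - eps / 2 +
       - (B / n%:R ^+ 2) * (k%:R - n%:R * y) ^+ 2)).[y] <=
    (bernstein n (fun k => G (k%:R / n%:R))).[y].
  by apply: bernstein_le => // k; have := key k; rewrite ler_norml => /andP[]; lra.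
rewrite !bernstein_quadratic in u1 u2.
by rewrite distrC ler_norml; apply/andP; split; lra.
Qed.

End weierstrass.

(** * From exponential test functions to C_0 *)

Section exp_dense.
Context {R : realType}.

Lemma continuous_abs_powR (a : R) : 0 < a -> continuous (fun x : R => `|x| `^ a).
Proof.
move=> a0 x; have [->|x0] := eqVneq x 0.
  apply/cvgrPdist_lt => e e0; rewrite normr0 powR0 ?gt_eqF//.
  near=> t; rewrite sub0r normrN ger0_norm ?powR_ge0//.
  have -> : e = (e `^ (a^-1)) `^ a by rewrite -powRrM mulVf ?gt_eqF// powRr1// ltW.
  apply: gt0_ltr_powR; rewrite ?nnegrE ?powR_ge0//.
  near: t; apply/nbhs_ballP; exists (e `^ a^-1); first by rewrite /= powR_gt0.
  by move=> t; rewrite /ball/= sub0r normrN.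
apply: (@continuous_comp _ _ _ (fun x : R => `|x|) (fun x => x `^ a)).
  exact: norm_continuous.
by apply: continuous_powR; rewrite normr_gt0.
Unshelve. all: by end_near. Qed.

Variables (N : R) (h : R -> R) (M : R).
Hypotheses (N0 : 0 < N) (ch : continuous h) (hM : forall x, `|h x| <= M).
Hypothesis h0 : h x @[x --> +oo] --> 0.

(** The function h in the variable y = exp(-|x|^N); since h vanishes at infinity,
   it extends continuously by 0 to y <= 0. *)
Let G (y : R) : R := if y <= 0 then 0 else h (`|ln y| `^ N^-1).

Let cG : continuous G.
Proof.
move=> y; case: (ltrgtP y 0) => [y0|y0|->].
- rewrite /continuous_at {2}/G ltW//; apply: cvg_near_cst.
  by near=> t; rewrite /G ltW//; near: t; exact: lt_nbhsl.
- rewrite /continuous_at {2}/G leNgt y0/=.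
  apply: (@cvg_trans _ ((fun z => h (`|ln z| `^ N^-1)) z @[z --> y])).
    apply: near_eq_cvg; near=> z; rewrite /G leNgt ifF//; apply/negbTE; rewrite negbK.
    by near: z; exact: lt_nbhsr.
  apply: (@continuous_comp _ _ _ (fun z => `|ln z| `^ N^-1) h); last exact: ch.
  apply: (@continuous_comp _ _ _ (@ln R) (fun z => `|z| `^ N^-1)).
    exact: continuous_ln.
  by apply: continuous_abs_powR; rewrite invr_gt0.
- rewrite /continuous_at {2}/G lexx; apply/cvgrPdist_lt => e e0.
  have /cvgrPdist_lt/(_ _ e0)[A [Ar hA]] := h0.
  pose A' := Num.max A 0 + 1.
  have A'0 : 0 < A' by rewrite ltr_wpDl// le_max lexx orbT.
  have AA' : A < A' by rewrite ltr_pwDr// le_max lexx.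
  have : \forall t \near (0 : R), `|0 - G t| < e; last exact.
  near=> t; rewrite /G; have [t0|t0] := leP t 0.
    by rewrite subr0 normr0.
  apply: hA; apply: (lt_trans AA').
  have -> : A' = (A' `^ N) `^ N^-1 by rewrite -powRrM mulfV ?gt_eqF// powRr1// ltW.
  apply: gt0_ltr_powR; rewrite ?nnegrE ?powR_ge0 ?invr_gt0//.
  apply: (@lt_le_trans _ _ (- ln t)); last by rewrite -normrN ler_norm.
  rewrite ltrNr -ltr_expR lnK ?posrE//.
  near: t; apply: lt_nbhsl; exact: expR_gt0.
Unshelve. all: by end_near. Qed.

Lemma exp_dense (eps : R) : 0 < eps -> exists p : {poly R},
  forall x : R, `|h `|x| - p.[expR (- `|x| `^ N)]| <= eps.
Proof.
move=> eps0; have GM y : `|G y| <= M.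
  by rewrite /G; case: ifP => // _; rewrite normr0 (le_trans _ (hM 0)).
have [p hp] := weierstrass_unit cG GM eps0.
exists p => x.
have := hp (expR (- `|x| `^ N)).
rewrite expR_ge0 expR_le1 oppr_le0 powR_ge0 => /(_ isT).
have -> // : G (expR (- `|x| `^ N)) = h `|x|.
rewrite /G leNgt expR_gt0/= expRK normrN (ger0_norm (powR_ge0 _ _)) -powRrM.
by rewrite mulfV ?gt_eqF// powRr1.
Qed.

End exp_dense.

Section convergence_class.
Context {R : realType}.
Variables (m : nat -> probability (measurableTypeR R) R)
  (m_oo : probability (measurableTypeR R) R).

Definition cvg_int (f : R -> R) : Prop :=
  [/\ measurable_fun setT f, (exists M : R, forall x, `|f x| <= M) &
      \int[m n]_x f x @[n --> \oo] --> \int[m_oo]_x f x].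

Lemma integrable_bounded (p : probability (measurableTypeR R) R) (f : R -> R) (M : R) :
  measurable_fun setT f -> (forall x, `|f x| <= M) ->
  p.-integrable setT (EFin \o f).
Proof.
move=> mf fM.
have M0 : 0 <= M by apply: le_trans (fM 0).
apply: (@le_integrable _ _ _ p setT _ _ (cst M%:E)) => //.
- exact/measurable_EFinP.
- by move=> x _ /=; rewrite lee_fin (ger0_norm M0).
- exact: finite_measure_integrable_cst.
Qed.

Lemma Rintegral_cst_prob (p : probability (measurableTypeR R) R) (c : R) :
  \int[p]_x c = c.
Proof.
rewrite Rintegral_cst// -[RHS]mulr1; congr (_ * _).
exact: (congr1 fine (probability_setT p)).
Qed.

Lemma Rintegral_dist_le (p : probability (measurableTypeR R) R) (f g : R -> R) (eps : R) :
  p.-integrable setT (EFin \o f) -> p.-integrable setT (EFin \o g) ->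
  (forall x, `|f x - g x| <= eps) ->
  `|\int[p]_x f x - \int[p]_x g x| <= eps.
Proof.
move=> fi gi fg; rewrite -RintegralB//.
have fgi : p.-integrable setT (EFin \o (fun x => f x - g x)).
  by apply: eq_integrable (integrableB _ fi gi).
apply: (le_trans (le_normr_Rintegral _ fgi)) => //.
rewrite -[leRHS](Rintegral_cst_prob p); apply: le_Rintegral => //.
- exact: integrable_norm.
- exact: finite_measure_integrable_cst.
Qed.

Lemma cvg_int_cst c : cvg_int (cst c).
Proof.
split; [exact: measurable_cst|by exists `|c| |].
by under eq_fun do rewrite Rintegral_cst_prob; rewrite Rintegral_cst_prob; exact: cvg_cst.
Qed.

Lemma cvg_intD f g : cvg_int f -> cvg_int g -> cvg_int (fun x => f x + g x).
Proof.
move=> [mf [Mf fM] cf] [mg [Mg gM] cg]; split.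
- exact: measurable_funD.
- by exists (Mf + Mg) => x; apply: (le_trans (ler_normD _ _)); exact: lerD.
have fi p := integrable_bounded p mf fM; have gi p := integrable_bounded p mg gM.
have DE (p : probability (measurableTypeR R) R) :
    \int[p]_x (f x + g x) = \int[p]_x f x + \int[p]_x g x 
  by rewrite (RintegralD _ (fi p) (gi p)).
by under eq_fun do rewrite DE; rewrite DE; exact: cvgD.
Qed.

Lemma cvg_intZ c f : cvg_int f -> cvg_int (fun x => c * f x).
Proof.
move=> [mf [Mf fM] cf]; split.
- exact: measurable_funM.
- by exists (`|c| * Mf) => x; rewrite normrM ler_wpM2l.
have fi p := integrable_bounded p mf fM.
have ZE (p : probability (measurableTypeR R) R) :
    \int[p]_x (c * f x) = c * \int[p]_x f x 
  by rewrite (RintegralZl _ _ (fi p)).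
by under eq_fun do rewrite ZE; rewrite ZE; exact: cvgMl_tmp.
Qed.

Lemma cvg_int_sum n (f : nat -> R -> R) :
  (forall k, cvg_int (f k)) -> cvg_int (fun x => \sum_(k < n) f k x).
Proof.
move=> cf; elim: n => [|n IH].
  rewrite (_ : (fun _ => _) = cst 0); first exact: cvg_int_cst.
  by apply/funext => x; rewrite big_ord0.
rewrite (_ : (fun _ => _) = (fun x => \sum_(k < n) f k x + f n x)); first exact: cvg_intD.
by apply/funext => x; rewrite big_ord_recr.
Qed.

(** Replacing f by g changes every integral by at most eps, uniformly in n,
    because the measures have mass one. *)
Lemma cvg_int_unif (f : R -> R) (M : R) :
  measurable_fun setT f -> (forall x, `|f x| <= M) ->
  (forall eps, 0 < eps -> exists2 g, cvg_int g & forall x, `|f x - g x| <= eps) ->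
  cvg_int f.
Proof.
move=> mf fM H; split=> //; first by exists M.
apply/cvgrPdist_lt => e e0.
have e4 : 0 < e / 4 by rewrite divr_gt0.
have [g [mg [Mg gM] cg] fg] := H _ e4.
have fi p := integrable_bounded p mf fM; have gi p := integrable_bounded p mg gM.
have /cvgrPdist_lt/(_ _ e4) := cg.
apply: filterS => n hn.
have h1 := Rintegral_dist_le (fi (m n)) (gi (m n)) fg.
have h2 := Rintegral_dist_le (fi m_oo) (gi m_oo) fg.
move: hn h1 h2.
move: (\int[m_oo]_x f x) (\int[m_oo]_x g x) => a b.
move: (\int[m n]_x f x) (\int[m n]_x g x) => c d.
rewrite ltr_norml !ler_norml ltr_norml => /andP[? ?] /andP[? ?] /andP[? ?].
by apply/andP; split; lra.
Qed.

Lemma C0_bounded (g : R -> R) : continuous g -> g x @[x --> +oo] --> 0 ->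
  g x @[x --> -oo] --> 0 -> exists M : R, forall x, `|g x| <= M.
Proof.
move=> cg gp gn.
have /cvgrPdist_lt/(_ _ ltr01)[A [Ar hA]] := gp.
have /cvgrPdist_lt/(_ _ ltr01)[B [Br hB]] := gn.
pose K : R := Num.max `|A| `|B|.
have KA : A <= K by rewrite le_max ler_norm.
have KB : - K <= B by rewrite lerNl le_max -(normrN B) ler_norm orbT.
have K_ge0 : 0 <= K by rewrite le_max normr_ge0.
have K0 : - K <= K by lra.
have cgn : continuous (fun x => `|g x|).
  by move=> x; apply: continuous_comp; [exact: cg|exact: norm_continuous].
have [c _ hc] := EVT_max K0 (continuous_subspaceT cgn).
exists (Num.max `|g c| 1) => x; rewrite le_max.
have [xB|xB] := ltP x (- K).
  by have := hB x (lt_le_trans xB KB); rewrite sub0r normrN => /ltW ->; rewrite orbT.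
have [xA|xA] := ltP K x.
  by have := hA x (le_lt_trans KA xA); rewrite sub0r normrN => /ltW ->; rewrite orbT.
by rewrite hc// in_itv/= xB xA.
Qed.

Variable nu : R.
Hypothesis nu0 : 0 < nu.
Let N := nu + 2.
Let N0 : 0 < N. Proof. by rewrite addr_gt0. Qed.

Hypothesis cvg_even : forall s : R, 0 < s ->
  \int[m n]_x expR (- (s * `|x| `^ N)) @[n --> \oo] -->
  \int[m_oo]_x expR (- (s * `|x| `^ N)).
Hypothesis cvg_odd : forall s : R, 0 < s ->
  \int[m n]_x (x * `|x| `^ nu * expR (- (s * `|x| `^ N))) @[n --> \oo] -->
  \int[m_oo]_x (x * `|x| `^ nu * expR (- (s * `|x| `^ N))).

Let E (x : R) : R := expR (- `|x| `^ N).

Let EX k x : E x ^+ k = expR (- (k%:R * `|x| `^ N)).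
Proof. by rewrite /E -expRM_natl mulrN. Qed.

Let cE : continuous E.
Proof.
move=> x; apply: (@continuous_comp _ _ _ (fun x : R => - `|x| `^ N) expR).
  by apply: cvgN; exact: continuous_abs_powR.
exact: continuous_expR.
Qed.

Let E_le1 x : E x <= 1.
Proof. by rewrite expR_le1 oppr_le0 powR_ge0. Qed.

Let W (x : R) : R := x * `|x| `^ nu * E x.

Let cW : continuous W.
Proof.
move=> x; apply: cvgM; last exact: cE.
by apply: cvgM; [exact: cvg_id|exact: continuous_abs_powR].
Qed.

(** Because |x|^(nu+1) <= 1 + |x|^N <= exp(|x|^N). *)
Let W_le1 x : `|W x| <= 1.
Proof.
rewrite /W normrM (gtr0_norm (expR_gt0 _)) /E expRN ler_pdivrMr ?expR_gt0// mul1r.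
apply: le_trans (expR_ge1Dx _).
rewrite normrM [X in _ * X]ger0_norm ?powR_ge0//.
have [x0|x0] := eqVneq x 0; first by rewrite x0 normr0 mul0r addr_ge0 ?powR_ge0.
rewrite -[X in X * _](powRr1 (normr_ge0 x)) -powRD; last by rewrite normr_eq0 x0 implybT.
have x0' : 0 < `|x| by rewrite normr_gt0.
have [x1|x1] := leP `|x| 1.
  rewrite (@le_trans _ _ 1) ?lerDl ?powR_ge0//.
  rewrite -[leRHS](powRr0 `|x|); apply: ger_powR; first by rewrite x0'.
  by rewrite addr_ge0// ltW.
rewrite (@le_trans _ _ (`|x| `^ N)) ?lerDr//; apply: ler_powR; first exact: ltW.
by rewrite /N addrC lerD2l ler1n.
Qed.

Let cvg_int_E k : cvg_int (fun x => E x ^+ k).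
Proof.
split.
- by apply: measurable_funX; exact: continuous_measurable_fun cE.
- exists 1 => x; rewrite normrX exprn_ile1//.
  by rewrite gtr0_norm ?expR_gt0.
case: k => [|k].
  under eq_fun do under eq_Rintegral do rewrite expr0.
  under eq_Rintegral do rewrite expr0.
  by have [] := cvg_int_cst 1.
under eq_fun do under eq_Rintegral do rewrite EX.
under eq_Rintegral do rewrite EX.
exact: cvg_even.
Qed.

Let cvg_int_WE k : cvg_int (fun x => W x * E x ^+ k).
Proof.
split.
- apply: measurable_funM; first exact: continuous_measurable_fun cW.
  by apply: measurable_funX; exact: continuous_measurable_fun cE.
- exists 1 => x; rewrite normrM mulr_ile1// normrX exprn_ile1//.
  by rewrite gtr0_norm ?expR_gt0.
under eq_fun do under eq_Rintegral do rewrite /W -mulrA -exprS EX.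
under eq_Rintegral do rewrite /W -mulrA -exprS EX.
exact: cvg_odd.
Qed.

Let cvg_int_polyE (p : {poly R}) : cvg_int (fun x => p.[E x]).
Proof.
rewrite (_ : (fun _ => _) = (fun x => \sum_(k < size p) p`_k * E x ^+ k)).
  exact: (cvg_int_sum (size p) (fun k => cvg_intZ p`_k (cvg_int_E k))).
by apply/funext => x; rewrite horner_coef.
Qed.

Let cvg_int_WpolyE (p : {poly R}) : cvg_int (fun x => W x * p.[E x]).
Proof.
rewrite (_ : (fun _ => _) = (fun x => \sum_(k < size p) p`_k * (W x * E x ^+ k))).
  exact: (cvg_int_sum (size p) (fun k => cvg_intZ p`_k (cvg_int_WE k))).
apply/funext => x; rewrite horner_coef mulr_sumr.
by apply: eq_bigr => k _; rewrite mulrCA.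
Qed.

Lemma cvg_int_even (h : R -> R) (M : R) : continuous h -> (forall x, `|h x| <= M) ->
  h x @[x --> +oo] --> 0 -> cvg_int (fun x => h `|x|).
Proof.
move=> ch hM h0; apply: (@cvg_int_unif _ M) => //.
  apply: continuous_measurable_fun => x.
  exact: (@continuous_comp _ _ _ (fun x : R => `|x|) h _ (@norm_continuous _ _ x) (ch _)).
move=> eps eps0; have [p hp] := exp_dense N0 ch hM h0 eps0.
by exists (fun x => p.[E x]).
Qed.

Let normW x : `|W x| = `|x| * `|x| `^ nu * E x.
Proof.
by rewrite !normrM (gtr0_norm (expR_gt0 _)) [X in _ * X * _]ger0_norm ?powR_ge0.
Qed.

Let W_lower (r A x : R) : 0 < r -> r <= `|x| -> `|x| <= A ->
  r * r `^ nu * expR (- A `^ N) <= `|W x|.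
Proof.
move=> r0 rx xA; have A0 : 0 <= A by apply: le_trans xA.
rewrite normW; apply: ler_pM; last 1 first.
- rewrite ler_expR lerN2; apply: ge0_ler_powR; rewrite ?nnegrE//; exact: ltW.
- by rewrite mulr_ge0 ?powR_ge0// ltW.
- exact: expR_ge0.
apply: ler_pM => //; [exact: ltW|exact: powR_ge0|].
by apply: ge0_ler_powR; rewrite ?nnegrE//; exact: ltW.
Qed.

(** W vanishes at 0 and at infinity, so that f / W may be unbounded for an odd f
    of C_0(R), whereas f / (|W| + d) is again in C_0(R).  The resulting factor
    |W| / (|W| + d) changes f little: it is close to 1 where |W| is bounded
    below, and f is small elsewhere. *)
Let W_damping (f : R -> R) (M eps : R) : continuous f -> f 0 = 0 ->
  (forall x, `|f x| <= M) -> (forall x, `|f `|x| | = `|f x|) ->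
  f x @[x --> +oo] --> 0 -> 0 < eps ->
  exists2 d, 0 < d & forall x, `|f x - `|W x| * f x / (`|W x| + d)| <= eps.
Proof.
move=> cf f00 fM fabs f0 eps0.
have M0 : 0 <= M by apply: le_trans (fM 0).
have [r r0 hr] : exists2 r, 0 < r & forall x, `|x| < r -> `|f x| < eps.
  have /cvgrPdist_lt/(_ _ eps0)/nbhs_ballP[r r0 hr] := cf 0.
  exists r => // x xr; have := hr x; rewrite f00 sub0r normrN; apply.
  by rewrite /ball/= sub0r normrN.
have /cvgrPdist_lt/(_ _ eps0)[A [_ hA]] := f0.
pose w0 : R := r * r `^ nu * expR (- A `^ N).
have w00 : 0 < w0 by rewrite mulr_gt0 ?expR_gt0// mulr_gt0// powR_gt0.
have M1 : 0 < M + 1 by rewrite ltr_wpDl.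
have d0 : 0 < eps * w0 / (M + 1) by rewrite divr_gt0// mulr_gt0.
exists (eps * w0 / (M + 1)) => // x.
have fx_or : `|f x| <= eps \/ w0 <= `|W x|.
  have [xr|xr] := ltP `|x| r; first by left; exact/ltW/hr.
  have [xA|xA] := ltP A `|x|; last by right; exact: W_lower.
  by left; have := hA _ xA; rewrite sub0r normrN fabs => /ltW.
have fxM := fM x; have dE : eps * w0 / (M + 1) * (M + 1) = eps * w0.
  by rewrite divfK// gt_eqF.
move: d0 dE; set d := eps * w0 / _ => d0 dE.
move: (normr_ge0 (W x)) fx_or fxM; move: `|W x| (f x) => w v w_ge0 v_or vM.
have wd : 0 < w + d by rewrite ltr_wpDl.
have -> : v - w * v / (w + d) = v * d / (w + d) by field; rewrite gt_eqF.
rewrite normrM normfV (gtr0_norm wd) ler_pdivrMr// normrM (gtr0_norm d0).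
case: v_or => [v_le|w0w].
  by apply: ler_pM => //; [exact: ltW|rewrite lerDr].
apply: (@le_trans _ _ (d * (M + 1))).
  by rewrite mulrC ler_pM2l// (le_trans vM)// lerDl.
by rewrite dE ler_pM2l// (le_trans w0w)// lerDl ltW.
Qed.

(** The damped function f |W| / (|W| + d) equals W(x) h(|x|) with
    h = f / (|W| + d) continuous and vanishing at infinity, so that h(|x|) can be
    replaced by a polynomial in exp(-|x|^N). *)
Lemma cvg_int_odd (f : R -> R) (M : R) : continuous f -> (forall x, `|f x| <= M) ->
  f x @[x --> +oo] --> 0 -> (forall x, f (- x) = - f x) -> cvg_int f.
Proof.
move=> cf fM f0 fodd.
apply: (cvg_int_unif (continuous_measurable_fun cf) fM) => eps eps0.
have e2 : 0 < eps / 2 by rewrite divr_gt0.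
have f00 : f 0 = 0 by have := fodd 0; rewrite oppr0; lra.
have fabs x : `|f `|x| | = `|f x|.
  by case: (ger0P x) => // _; rewrite fodd normrN.
have [d d0 hd] := W_damping cf f00 fM fabs f0 e2.
have Wd x : 0 < `|W x| + d by rewrite ltr_wpDl.
pose h x := f x / (`|W x| + d).
have h_le x : `|h x| <= `|f x| / d.
  rewrite /h normrM normfV (gtr0_norm (Wd x)) ler_wpM2l// lef_pV2 ?posrE//.
  by rewrite lerDr.
have ch : continuous h.
  move=> x; apply: cvgM; first exact: cf.
  apply: cvgV; first by rewrite gt_eqF.
  apply: cvgD; last exact: cvg_cst.
  by apply: cvg_norm; exact: cW.
have hM x : `|h x| <= M / d.
  by apply: (le_trans (h_le x)); rewrite ler_pM2r ?invr_gt0.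
have h0 : h x @[x --> +oo] --> 0.
  apply/cvgrPdist_lt => e e0.
  have /cvgrPdist_lt/(_ _ (mulr_gt0 e0 d0)) := f0.
  apply: filterS => x; rewrite !sub0r !normrN => fx.
  by apply: (le_lt_trans (h_le x)); rewrite ltr_pdivrMr.
have [p hp] := exp_dense N0 ch hM h0 e2.
exists (fun x => W x * p.[E x]); first exact: cvg_int_WpolyE.
move=> x; have {}hp := hp x; have {}hd := hd x.
have WhE : W x * h `|x| = `|W x| * f x / (`|W x| + d).
  rewrite /h; have -> : `|W `|x| | = `|W x| by rewrite !normW normr_id /E normr_id.
  rewrite mulrA normW /W; case: (ger0P x) => // _; rewrite fodd; congr (_ / _).
  by move: (_ `^ _) (E _) (f x) => u v w; ring.
rewrite -WhE in hd.
have h2 : `|W x * h `|x| - W x * p.[E x]| <= eps / 2.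
  by rewrite -mulrBr normrM -[leRHS]mul1r; exact: ler_pM.
rewrite [X in `|X|](_ : _ = (f x - W x * h `|x|) + (W x * h `|x| - W x * p.[E x])).
  apply: (le_trans (ler_normD _ _)); apply: (le_trans (lerD hd h2)).
  by rewrite -(splitr eps).
by rewrite addrA subrK.
Qed.

Lemma cvg_int_C0 (g : R -> R) : continuous g -> g x @[x --> +oo] --> 0 ->
  g x @[x --> -oo] --> 0 -> cvg_int g.
Proof.
move=> cg gp gn; have [M gM] := C0_bounded cg gp gn.
have gNp : g (- x) @[x --> +oo] --> 0 by apply/cvgNy_compNP.
have cgN : continuous (fun x => g (- x)).
  by move=> x; apply: continuous_comp; [exact: continuousN|exact: cg].
pose ge x := 2^-1 * (g x + g (- x)).
pose go x := 2^-1 * (g x - g (- x)).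
have -> : g = fun x => ge `|x| + go x.
  apply/funext => x; have -> : ge `|x| = ge x.
    by case: (ger0P x) => // _; rewrite /ge opprK addrC.
  by rewrite /ge /go; field.
apply: cvg_intD.
- apply: (@cvg_int_even ge M).
  + by move=> x; apply: cvgMl_tmp; apply: cvgD; [exact: cg|exact: cgN].
  + move=> x; rewrite normrM ger0_norm ?invr_ge0// ler_pdivrMl//.
    by apply: (le_trans (ler_normD _ _)); have := gM x; have := gM (- x); lra.
  + by rewrite -[X in _ --> X](mulr0 (2^-1)) -[X in _ * X](addr0 0); apply: cvgMl_tmp; apply: cvgD.
- apply: (@cvg_int_odd go M).
  + by move=> x; apply: cvgMl_tmp; apply: cvgB; [exact: cg|exact: cgN].
  + move=> x; rewrite normrM ger0_norm ?invr_ge0// ler_pdivrMl//.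
    by apply: (le_trans (ler_normB _ _)); have := gM x; have := gM (- x); lra.
  + by rewrite -[X in _ --> X](mulr0 (2^-1)) -[X in _ * X](subr0 0); apply: cvgMl_tmp; apply: cvgB.
  + by move=> x; rewrite /go opprK; ring.
Qed.

End convergence_class.

(** * Complex-valued limits and the theorem *)

Local Open Scope complex_scope.
Section complex_cvg.
Context {R : realType}.

Lemma normc_ge_Im (z : R[i]) : `|complex.Im z|%:C <= `|z|.
Proof.
rewrite normc_def lecR -sqrtr_sqr ler_sqrt ?addr_ge0 ?sqr_ge0//.
by rewrite lerDr sqr_ge0.
Qed.

Lemma normc_le_ReIm (z : R[i]) : `|z| <= (`|complex.Re z| + `|complex.Im z|)%:C.
Proof.
rewrite normc_def lecR -[leRHS]ger0_norm ?addr_ge0// -sqrtr_sqr.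
rewrite ler_sqrt ?sqr_ge0// sqrrD !real_normK ?num_real//.
by rewrite lerD2r lerDl mulrn_wge0// mulr_ge0.
Qed.

Context {T : Type} {F : set_system T} {FF : Filter F}.

Lemma cvg_ReIm (f : T -> R[i]^o) (l : R[i]^o) : f @ F --> l <->
  (fun x => complex.Re (f x)) @ F --> complex.Re l /\
  (fun x => complex.Im (f x)) @ F --> complex.Im l.
Proof.
split=> [/cvgrPdist_lt fl|[/cvgrPdist_lt fr /cvgrPdist_lt fi]].
  split; apply/cvgrPdist_lt => e e0; have /fl : 0 < e%:C by rewrite ltcR.
    apply: filterS => x h; rewrite -ltcR; apply: le_lt_trans h.
    by rewrite -(raddfB (@complex.Re R : {additive R[i] -> R})) normc_ge_Re.
  apply: filterS => x h; rewrite -ltcR; apply: le_lt_trans h.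
  by rewrite -(raddfB (@complex.Im R : {additive R[i] -> R})) normc_ge_Im.
apply/cvgrPdist_lt => -[e e']; rewrite ltcE/= => /andP[/eqP-> e0].
have e2 : 0 < e / 2 by rewrite divr_gt0.
move: (fr _ e2) (fi _ e2); apply: filterS2 => x h1 h2.
apply: le_lt_trans (normc_le_ReIm _) _; rewrite ltcR.
rewrite (raddfB (@complex.Re R : {additive R[i] -> R})).
rewrite (raddfB (@complex.Im R : {additive R[i] -> R})).
by lra.
Qed.

End complex_cvg.

(* N u {oo} is `option nat`, with `None` standing for oo. *)
Theorem proposition3p5 (R : realType) (nu : R)
    (mu : option nat -> probability (measurableTypeR R) R) :
  0 < nu ->
  (ereal_sup (range (fun n : option nat =>
     \int[mu n]_x (`|x| `^ (nu / 4))%:E)) < +oo)%E ->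
  (forall q : R,
     (fun n : nat => Lcharfun nu (mu (Some n)) q : R[i]^o) @ \oo -->
       (Lcharfun nu (mu None) q : R[i]^o)) ->
  vague_cvg (fun n : nat => mu (Some n)) (mu None).
Proof.
move=> nu0 sup_lty hphi.
set I := (fun n : option nat => _) in sup_lty.
have I_le n : (I n <= ereal_sup (range I))%E by apply: ereal_sup_ubound; exists n.
have I_ge0 n : (0 <= I n)%E.
  by apply: integral_ge0 => x _; rewrite lee_fin powR_ge0.
have supE : ereal_sup (range I) = (fine (ereal_sup (range I)))%:E.
  by rewrite fineK// ge0_fin_numE//; exact: le_trans (I_ge0 None) (I_le None).
have hM n : (I n <= (fine (ereal_sup (range I)))%:E)%E by rewrite -supE.
have LE (n : option nat) q : Lcharfun nu (mu n) q =
    (transform (evec_re nu) (mu n) q +i* transform (evec_im nu) (mu n) q)%C.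
  by congr (_ +i* _)%C; apply: eq_Rintegral => x _; rewrite evecE.
have hre q : transform (evec_re nu) (mu (Some n)) q @[n --> \oo] -->
    transform (evec_re nu) (mu None) q.
  have [+ _] := (cvg_ReIm _ _).1 (hphi q).
  by under eq_fun do rewrite LE/=; rewrite LE.
have him q : transform (evec_im nu) (mu (Some n)) q @[n --> \oo] -->
    transform (evec_im nu) (mu None) q.
  have [_ +] := (cvg_ReIm _ _).1 (hphi q).
  by under eq_fun do rewrite LE/=; rewrite LE.
have even_cvg (s : R) (s0 : 0 < s) :=
  cvg_integral_even nu0 (fun n => hM (Some n)) (hM None) s0 hre.
have odd_cvg (s : R) (s0 : 0 < s) :=
  cvg_integral_odd nu0 (fun n => hM (Some n)) (hM None) s0 him.
move=> g [cg gp gn]; apply/cvg_ReIm => /=.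
have [gpr gpi] := (cvg_ReIm _ _).1 gp.
have [gnr gni] := (cvg_ReIm _ _).1 gn.
split.
  by have [_ _] := cvg_int_C0 nu0 even_cvg odd_cvg
    (fun x => ((cvg_ReIm _ _).1 (cg x)).1) gpr gnr.
by have [_ _] := cvg_int_C0 nu0 even_cvg odd_cvg
  (fun x => ((cvg_ReIm _ _).1 (cg x)).2) gpi gni.
Qed.
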